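(* Every treelike snark is frumious.
   Context: Graphs may contain parallel edges but no loops; bridgeless means $2$-edge-connected. A multigraph is Class I if its chromatic index equals its maximum degree. For a perfect matching $M$ of $G$ and an integer $t\ge 0$, $G+tM$ is the multigraph obtained from $G$ by adding $t$ parallel edges to every edge of $M$. $l_M(G)$ is the minimum $t\ge 0$ such that $G+tM$ is Class I, and $l_M(G)=+\infty$ if no such $t$ exists. A bridgeless cubic graph $G$ is frumious if $l_M(G)=+\infty$ for all perfect matchings $M$ of $G$. A snark is a bridgeless cubic graph with chromatic index $4$ (every frumious graph is a snark). A dangling edge is an edge having exactly one end-vertex. A $4$-pole is what is obtained from a vertex subset $U$ of a cubic graph with exactly four edges leaving $U$, by taking the subgraph induced by $U$ together with these four edges as dangling edges (so each vertex has degree $3$, counting dangling edges). Joining a dangling edge with end-vertex $x$ to a vertex $y$ means deleting the dangling edge and making $x$ and $y$ adjacent. Let $A$ be a $4$-pole whose four dangling edges are partitioned into ordered pairs $(l_1,l_2)$ (first and second left dangling edges) and $(r_1,r_2)$ (first and second right dangling edges), and let $u_1,u_2,v_1,v_2$ be the end-vertices of $l_1,l_2,r_1,r_2$, respectively. $A$ is frumious (with respect to this partition) if the graph obtained by removing the four dangling edges and adding two new vertices $u,v$, with $u$ adjacent to $v,u_1,u_2$ and $v$ adjacent to $u,v_1,v_2$, is a frumious snark. A Halin graph is a plane graph consisting of a planar representation of a tree without degree $2$ vertices and a circuit on the set of its leaves. Let $H$ be a cubic Halin graph consisting of the tree $T$ and the circuit $K$. A treelike snark is any cubic graph that can be obtained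 as follows: start from $T$; for every leaf $x$ of $T$ add two new vertices $x_1,x_2$ and the edges $xx_1,xx_2$; for every edge $xy$ of $K$, with $x$ the predecessor of $y$ in the clockwise orientation of $K$, replace the edge $xy$ with a frumious $4$-pole (possibly different ones for different edges), joining its first and second left dangling edges to $x_1$ and $x_2$, respectively, and its first and second right dangling edges to $y_1$ and $y_2$, respectively.
   Formalization: The tree of the Halin graph is required to have at least four vertices (the usual convention); this excludes the two-vertex tree with a circuit of two parallel edges, for which the claim fails, e.g. with two Petersen 4-poles. *)

(* Defs.v *)
From mathcomp Require Import all_boot all_fingroup.
From mathcomp Require Import boolp.

Set Implicit Arguments.
Unset Strict Implicit.
Unset Printing Implicit Defensive.

(** * Multigraphs *)

(* Finite, parallel edges allowed, no loops. *)
Record mgraph := MGraph {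
  vert : finType;
  edge : finType;
  ends : edge -> {set vert};
  card_ends : forall e, #|ends e| = 2 }.

Section Basics.
Variable G : mgraph.
Implicit Types (F C M : {set edge G}) (x y : vert G) (k t : nat).

(* Degree of [x] in the spanning subgraph with edge set [F]. *)
Definition deg F x := #|[set e in F | x \in ends e]|.

Definition degree x := deg [set: edge G] x.

Definition max_degree := \max_(x : vert G) degree x.

Definition cubic := forall x, degree x = 3.

Definition adj F : rel (vert G) :=
  fun x y => [exists e in F, ends e == [set x; y]].

(* The spanning subgraph with edge set [F] is connected. *)
Definition connected F := forall x y, connect (adj F) x y.

(* 2-edge-connected *)
Definition bridgeless :=
  connected [set: edge G] /\ forall e, connected [set~ e].

Definition proper_colouring k (c : {ffun edge G -> 'I_k}) :=
  [forall e, forall f,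
     (e != f) && ~~ [disjoint ends e & ends f] ==> (c e != c f)].

Definition edge_colourable k :=
  [exists c : {ffun edge G -> 'I_k}, proper_colouring c].

Lemma edge_colourable_ex : exists k, edge_colourable k.
Proof.
exists #|edge G|; apply/existsP; exists [ffun e => enum_rank e].
apply/forallP => e; apply/forallP => f; apply/implyP => /andP[nef _].
by rewrite !ffunE (inj_eq enum_rank_inj).
Qed.

Definition chromatic_index := ex_minn edge_colourable_ex.

Definition class1 := chromatic_index == max_degree.

Definition perfect_matching M := forall x, deg M x = 1.

(* A connected subgraph all of whose vertices have degree 2; two parallel edges
   form a circuit. *)
Definition circuit C :=
  [/\ C != set0,
      forall x, (deg C x == 0) || (deg C x == 2) &
      forall x y, 0 < deg C x -> 0 < deg C y -> connect (adj C) x y].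

Definition spanning_tree F :=
  connected F /\ forall C, C \subset F -> ~ circuit C.

End Basics.

Definition isomorphic (G G' : mgraph) :=
  exists (f : vert G -> vert G') (g : edge G -> edge G'),
    [/\ bijective f, bijective g & forall e, ends (g e) = f @: ends e].

(** * Frumious graphs *)

Section AddMatching.
Variables (G : mgraph) (M : {set edge G}) (t : nat).

Definition add_ends (e : edge G + {e : edge G | e \in M} * 'I_t) :
    {set vert G} :=
  match e with
  | inl e => ends e
  | inr (e, _) => ends (val e)
  end.

Lemma card_add_ends e : #|add_ends e| = 2.
Proof. by case: e => [e | [e i]]; apply: card_ends. Qed.

(* The multigraph G + tM. *)
Definition add_matching := MGraph card_add_ends.

End AddMatching.

(* [None] stands for +oo. *)
Definition l_index (G : mgraph) (M : {set edge G}) : option nat :=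
  if pselect (exists t, class1 (add_matching M t)) is left ex_t
  then Some (ex_minn ex_t) else None.

Definition frumious (G : mgraph) :=
  [/\ cubic G, bridgeless G &
      forall M : {set edge G}, perfect_matching M -> l_index M = None].

Definition snark (G : mgraph) :=
  [/\ cubic G, bridgeless G & chromatic_index G = 4].

(** * 4-poles *)

(* A 4-pole together with the partition of its dangling edges into ordered
   pairs: [dangling (s, i)] is a left dangling edge if [s = false] and a right
   one if [s = true]; it is the first of its pair if [i = false] and the second
   if [i = true]. *)
Record fourpole := FourPole {
  host : mgraph;
  host_cubic : cubic host;
  inside : {set vert host};
  dangling : bool * bool -> edge host;
  dangling_inj : injective dangling;
  danglingE : [set e | #|ends e :&: inside| == 1] = [set dangling d | d : bool * bool] }.

Section FourPole.
Variable A : fourpole.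

Definition pole_vert : finType := {x : vert (host A) | x \in inside A}.
Definition pole_edge : finType :=
  {e : edge (host A) | ends e \subset inside A}.

Definition pole_ends (e : pole_edge) : {set pole_vert} :=
  [set x | val x \in ends (val e)].

Lemma card_pole_ends e : #|pole_ends e| = 2.
Proof.
rewrite -(card_ends (val e)) -(card_imset _ val_inj); congr #|pred_of_set _|.
apply/setP => x; apply/imsetP/idP => [[y] | xe].
  by rewrite inE => ye ->.
by exists (Sub x (subsetP (valP e) x xe)) => //; rewrite inE.
Qed.

Lemma dangling_end_ex d :
  exists x : pole_vert, val x \in ends (dangling A d).
Proof.
have : dangling A d \in [set e | #|ends e :&: inside A| == 1].
  by rewrite danglingE imset_f.
rewrite inE => /cards1P[x defx].
have /setIP[xe xU] : x \in ends (dangling A d) :&: inside A.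
  by rewrite defx set11.
by exists (Sub x xU).
Qed.

(* The end-vertex of a dangling edge. *)
Definition dangling_end d : pole_vert := xchoose (dangling_end_ex d).

(* [inr false] and [inr true] are the new vertices u and v; [inr None] is the
   edge uv. *)
Definition closure_ends (e : pole_edge + option (bool * bool)) :
    {set pole_vert + bool} :=
  match e with
  | inl e => inl @: pole_ends e
  | inr None => [set inr false; inr true]
  | inr (Some d) => [set inr d.1; inl (dangling_end d)]
  end.

Lemma card_closure_ends e : #|closure_ends e| = 2.
Proof.
case: e => [e | [d |]] /=; rewrite ?cards2 //.
by rewrite card_imset ?card_pole_ends // => x y [].
Qed.

Definition pole_closure := MGraph card_closure_ends.

Definition frumious_pole := frumious pole_closure /\ snark pole_closure.

End FourPole.

(** * Halin graphs *)

(* The dart (x, e) is the edge e oriented away from its end x. *)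
Definition dart (G : mgraph) : finType :=
  {d : vert G * edge G | d.1 \in ends d.2}.
Definition dvert (G : mgraph) (d : dart G) := (val d).1.
Definition dedge (G : mgraph) (d : dart G) := (val d).2.

(* A connected plane graph, encoded by its rotation system: [rot] turns a dart
   clockwise around its initial vertex, [opp] reverses darts. The orbits of
   [rot \o opp] are the faces, traversed with the face on the left; planarity is
   Euler's formula. The plane, unlike the sphere, has a distinguished outer
   face, given by one of its darts. *)
Record plane_embedding (G : mgraph) := PlaneEmbedding {
  emb_connected : connected [set: edge G];
  rot : {perm dart G};
  opp : {perm dart G};
  rotP : forall d d', (d' \in porbit rot d) = (dvert d' == dvert d);
  oppP : forall d, dedge (opp d) = dedge d /\ dvert (opp d) <> dvert d;
  euler : #|vert G| + #|porbits (opp * rot)%g| = #|edge G| + 2;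
  outer_dart : dart G }.

Definition outer_face (G : mgraph) (P : plane_embedding G) : {set dart G} :=
  porbit (opp P * rot P)%g (outer_dart P).

(* The tree is drawn inside the circuit, i.e. the circuit bounds the outer face.
   The darts of the outer face, having that face on their left, are then the
   edges of the circuit in its clockwise orientation. As usual the tree has at
   least four vertices, which excludes the two-vertex tree with a circuit made
   of two parallel edges. *)
Record halin := Halin {
  hgraph :> mgraph;
  hplane : plane_embedding hgraph;
  htree : {set edge hgraph};
  hcirc : {set edge hgraph};
  htreeUcirc : htree :|: hcirc = [set: edge hgraph];
  htreeIcirc : htree :&: hcirc = set0;
  htreeP : spanning_tree htree;
  htree_size : 3 < #|vert hgraph|;
  htree_deg : forall x, deg htree x <> 2;
  hcircP : circuit hcirc;
  hcirc_leaves : forall x, (0 < deg hcirc x) = (deg htree x == 1);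
  houter : [set dedge d | d in outer_face hplane] = hcirc;
  houter_inj : {in outer_face hplane &, injective (@dedge hgraph)} }.

(** * Treelike snarks *)

Section Treelike.
Variable H : halin.

Definition leaf : finType := {x : vert H | deg (htree H) x == 1}.

(* The edges xy of the circuit, where x precedes y clockwise. *)
Definition circ_arc : finType := {d : dart H | d \in outer_face (hplane H)}.

Lemma circ_dart_leaf (d : dart H) :
  dedge d \in hcirc H -> deg (htree H) (dvert d) == 1.
Proof.
move=> dK; rewrite -hcirc_leaves card_gt0; apply/set0Pn; exists (dedge d).
by rewrite inE dK; apply: (valP d).
Qed.

Lemma circ_arc_edge (k : circ_arc) : dedge (val k) \in hcirc H.
Proof. by rewrite -houter imset_f ?(valP k). Qed.

Lemma circ_arc_opp_edge (k : circ_arc) :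
  dedge (opp (hplane H) (val k)) \in hcirc H.
Proof. by rewrite (oppP (hplane H) (val k)).1 circ_arc_edge. Qed.

Definition arc_tail (k : circ_arc) : leaf :=
  exist _ (dvert (val k)) (circ_dart_leaf (circ_arc_edge k)).
Definition arc_head (k : circ_arc) : leaf :=
  exist _ (dvert (opp (hplane H) (val k)))
    (circ_dart_leaf (circ_arc_opp_edge k)).

Variable A : circ_arc -> fourpole.

(* For a leaf x, [LeafV (x, false)] and [LeafV (x, true)] are x_1 and x_2. *)
Definition treelike_vert : finType :=
  (vert H + leaf * bool + {k : circ_arc & pole_vert (A k)})%type.
Definition TreeV (x : vert H) : treelike_vert := inl (inl x).
Definition LeafV (z : leaf * bool) : treelike_vert := inl (inr z).
Definition PoleV k (z : pole_vert (A k)) : treelike_vert :=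
  inr (Tagged (fun k => pole_vert (A k)) z).

(* In order: the edges of the tree, the edges x x_i, the edges of the 4-poles,
   and the edges arising from their dangling edges. *)
Definition treelike_edge : finType :=
  ({e : edge H | e \in htree H} + leaf * bool +
   {k : circ_arc & pole_edge (A k)} + circ_arc * (bool * bool))%type.

Definition treelike_ends (e : treelike_edge) : {set treelike_vert} :=
  match e with
  | inl (inl (inl e)) => TreeV @: ends (val e)
  | inl (inl (inr z)) => [set TreeV (val z.1); LeafV z]
  | inl (inr (existT k e)) => @PoleV k @: pole_ends e
  | inr (k, (s, i)) =>
      [set PoleV (dangling_end (A k) (s, i));
           LeafV (if s then arc_head k else arc_tail k, i)]
  end.

Lemma card_treelike_ends e : #|treelike_ends e| = 2.
Proof.
case: e => [[[e | z] | [k e]] | [k [s i]]] /=; rewrite ?cards2 //.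
  by rewrite card_imset ?card_ends // => x y [].
by rewrite card_imset ?card_pole_ends // => x y [] /eqP; rewrite eq_Tagged => /eqP.
Qed.

Definition treelike_graph := MGraph card_treelike_ends.

End Treelike.

Definition treelike_snark (G : mgraph) :=
  exists (H : halin) (A : circ_arc H -> fourpole),
    [/\ cubic H, forall k, frumious_pole (A k) &
        isomorphic (treelike_graph A) G].

(* Main.v *)
(* In a (t+3)-edge-colouring of G + tM every colour class is a perfect matching,
   so it amounts to a colour set for each edge of G, of size t + 1 on M and 1
   off M, in which every colour class is a perfect matching of G.  For a pole k
   let W_k be the set of colours occurring an odd number of times on its left
   dangling edges; by parity W_k is the same on the right.  If a side of k has
   at most one edge of M, and so has the other, then the colour sets on a side
   cannot be disjoint, as the colouring would then extend to the closure of k,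
   which is frumious.

   A leaf of the tree whose tree edge is not in M has on one side a pole with
   an odd number of M-edges and on the other a pole with no M-edge on the side
   of the leaf and W nonempty.  At a leaf whose tree edge is in M, the numbers
   of M-edges on the two sides add up to 2.  Hence some pole f has no dangling
   edge in M, and W_f is empty.  Its face in the plane drawing has two
   consecutive tree edges e1, e2, with e1 in M at a leaf, so e2 is not in M; the
   other face at e2 contains a single pole g, and e2 together with the right
   dangling edges of f and g is an edge cut of odd size.  Thus g is odd and its
   colours, which meet, would have to cover all t + 3 colours. *)

From mathcomp Require Import all_boot all_fingroup.
From mathcomp Require Import boolp zify.
Require Import Defs.

Set Implicit Arguments.
Unset Strict Implicit.
Unset Printing Implicit Defensive.

(** * Edge cuts and parity in cubic graphs *)

Section Graph.
Variable G : mgraph.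
Implicit Types (F M N : {set edge G}) (x y : vert G) (e : edge G).

Lemma degE F x : deg F x = \sum_(e | x \in ends e) (e \in F : nat).
Proof.
rewrite /deg -sum1_card big_mkcond [RHS]big_mkcond; apply: eq_bigr => e _.
by rewrite inE andbC; case: (x \in ends e); case: (e \in F).
Qed.

Lemma ends2 e x : x \in ends e -> exists2 y, x != y & ends e = [set x; y].
Proof.
move=> xe; have /cards2P[a [b [ab E]]] : #|ends e| == 2 by rewrite card_ends.
have := xe; rewrite E !inE => /orP[]/eqP xE; subst x; first by exists b.
by exists a; rewrite 1?eq_sym // setUC.
Qed.

Lemma ends_ex e : exists2 p, p.1 != p.2 & ends e = [set p.1; p.2].
Proof.
have /cards2P[a [b [ab E]]] : #|ends e| == 2 by rewrite card_ends.
by exists (a, b).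
Qed.

Lemma adj_sym F : symmetric (adj F).
Proof. by move=> x y; rewrite /adj; under eq_existsb => e do rewrite setUC. Qed.

Lemma connect_adj_sym F : connect_sym (adj F).
Proof. exact: sym_connect_sym (adj_sym F). Qed.

Lemma adjI F e x y : e \in F -> ends e = [set x; y] -> adj F x y.
Proof. by move=> eF E; apply/existsP; exists e; rewrite eF E eqxx. Qed.

Lemma adjP F x y : reflect (exists2 e, e \in F & ends e = [set x; y]) (adj F x y).
Proof.
apply: (iffP existsP) => [[e /andP[? /eqP?]]|[e eF E]]; first by exists e.
by exists e; rewrite eF E eqxx.
Qed.

Lemma connect_adjS F F' : F \subset F' -> subrel (connect (adj F)) (connect (adj F')).
Proof.
move=> /subsetP sF; apply: connect_sub => x y /adjP[e /sF eF E].
exact: connect1 (adjI eF E).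
Qed.

(* As [e] has two ends, this says that exactly one of them lies in [U]. *)
Definition crosses (U : {set vert G}) e := odd #|ends e :&: U|.

Lemma crossesE (U : {set vert G}) e x y : x != y -> ends e = [set x; y] ->
  crosses U e = (x \in U) (+) (y \in U).
Proof.
move=> xy E; rewrite /crosses E setIUl.
have I1 z : #|[set z] :&: U| = (z \in U).
  case zU: (z \in U); last by apply/eqP; rewrite cards_eq0 setI_eq0 disjoints1 zU.
  by rewrite (setIidPl _) ?sub1set ?cards1.
rewrite cardsU !I1 (_ : [set x] :&: U :&: ([set y] :&: U) = set0) ?cards0 ?subn0.
  by case: (x \in U); case: (y \in U).
by apply/setP => z; rewrite !inE; case: eqP => [->|]; rewrite ?(negbTE xy) ?andbF.
Qed.

Lemma odd_sum (I : finType) (P : pred I) (f : I -> nat) :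
  odd (\sum_(i | P i) f i) = \big[addb/false]_(i | P i) odd (f i).
Proof. exact: (big_morph odd oddD). Qed.

Lemma sum_degE F (U : {set vert G}) :
  \sum_(x in U) deg F x = \sum_(e in F) #|ends e :&: U|.
Proof.
under eq_bigr => x _ do rewrite degE.
rewrite (exchange_big_dep predT) //= [RHS]big_mkcond; apply: eq_bigr => e _.
rewrite sum_nat_const; set a := #|_|; have -> : a = #|ends e :&: U|.
  by apply: eq_card => x; rewrite !inE andbC.
by case: (e \in F); rewrite ?muln1 ?muln0.
Qed.

(** Both sums have the parity of |U|: summing degrees over [U] counts crossing edges once and inner
    edges twice, and every vertex of [U] has odd degree both in [F] and in [G]. *)
Lemma parity_cut F (U : {set vert G}) : cubic G -> perfect_matching F ->
  odd (\sum_(e | crosses U e) (e \in F : nat)) = odd (\sum_(e | crosses U e) 1).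
Proof.
move=> cG pF; transitivity (odd #|U|).
  rewrite -sum1_card -(eq_bigr _ (fun x _ => pF x)) sum_degE !odd_sum.
  rewrite big_mkcond [RHS]big_mkcond; apply: eq_bigr => e _ /=.
  by rewrite /crosses; case: odd; case: (e \in F).
have -> : odd #|U| = odd (\sum_(x in U) deg [set: edge G] x).
  by under eq_bigr => x _ do rewrite -/(degree x) cG; rewrite sum_nat_const oddM andbT.
rewrite sum_degE !odd_sum big_mkcond [RHS]big_mkcond; apply: eq_bigr => e _ /=.
by rewrite inE /crosses; case: odd.
Qed.

(** [s e] collects the colours of all parallel copies of [e], which keeps every later argument on
    the edges of [G] itself. *)
Definition good t M (s : edge G -> {set 'I_(t + 3)}) :=
  [/\ perfect_matching M, forall e, #|s e| = (if e \in M then t.+1 else 1)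
    & forall c, perfect_matching [set e | c \in s e]].

End Graph.

Section Matching.
Variable G : mgraph.
Implicit Types (F M N : {set edge G}) (x y : vert G) (e f : edge G).

Lemma pm_inj F x e f : perfect_matching F ->
  e \in F -> f \in F -> x \in ends e -> x \in ends f -> e = f.
Proof.
move=> pF eF fF xe xf; have /eqP/cards1P[g E] := pF x.
have: e \in [set g] by rewrite -E inE eF.
have: f \in [set g] by rewrite -E inE fF.
by rewrite !inE => /eqP-> /eqP->.
Qed.

Lemma degree_le_colours k x : edge_colourable G k -> degree x <= k.
Proof.
case/existsP=> c /forallP cP; rewrite /degree /deg -[k]card_ord.
rewrite -(card_in_imset (f := c)) ?max_card // => e f; rewrite !inE /= => xe xf.
apply: contra_eq => nef; have /forallP/(_ f) := cP e; rewrite nef /=.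
by move/implyP; apply; apply/pred0Pn; exists x; apply/andP.
Qed.

End Matching.

(** * Colourings of G + tM as colour sets on G *)

Section AddMatching.
Variables (G : mgraph) (M : {set edge G}) (t : nat).
Local Notation K := (add_matching M t).

Definition base_edge (f : edge K) : edge G :=
  match f with inl e => e | inr (p, _) => val p end.
(** The original edge is copy 0 and the added ones are shifted by one, so the copies of an edge are
    numbered consecutively and can index the list of its colours. *)
Definition copy_index (f : edge K) : nat :=
  match f with inl _ => 0 | inr (_, i) => i.+1 end.

Lemma ends_base f : ends f = ends (base_edge f).
Proof. by case: f => [e|[p i]]. Qed.

Lemma copy_inj f f' : base_edge f = base_edge f' -> copy_index f = copy_index f' -> f = f'.
Proof.
case: f f' => [e|[p i]] [e'|[p' i']] //= E; first by rewrite E.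
by case=> /ord_inj->; rewrite (val_inj E).
Qed.

Lemma copy_lt f : copy_index f < (if base_edge f \in M then t.+1 else 1).
Proof. by case: f => [e|[p i]] /=; rewrite ?(valP p) ?ltnS //; case: ifP. Qed.

Lemma card_copies e : #|[set f | base_edge f == e]| = (if e \in M then t.+1 else 1).
Proof.
rewrite -sum1_card; under eq_bigl => f do rewrite inE.
rewrite big_sumType /= big_pred1_eq.
have -> : \sum_(i : {e | e \in M} * 'I_t | base_edge (inr i : edge K) == e) 1 =
   \sum_(p : {e | e \in M} | val p == e) t.
  rewrite -[in RHS](card_ord t) -sum1_card.
  rewrite (pair_big (fun p : {e | e \in M} => val p == e) predT (fun _ _ => 1)) /=.
  by apply: eq_bigl => -[p i]; rewrite /= andbT.
case: ifP => eM; last by rewrite big1 // => p /eqP pe; have := valP p; rewrite pe eM.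
by rewrite (big_pred1 (exist _ e eM : {e | e \in M})).
Qed.

Lemma degree_add x : degree (x : vert K) = degree (x : vert G) + t * deg M x.
Proof.
rewrite /degree !degE (partition_big base_edge (fun e => x \in ends e)) /=; last first.
  by move=> f; rewrite -[add_ends f]/(ends (f : edge K)) ends_base.
rewrite big_distrr /= -big_split /=; apply: eq_bigr => e xe.
transitivity #|[set f | base_edge f == e]|.
  rewrite -sum1_card; apply: eq_big => f; rewrite ?inE ?andTb //.
  by rewrite -[add_ends f]/(ends (f : edge K)) ends_base; case: eqP => [->|]; rewrite ?andbT ?andbF.
by rewrite card_copies inE; case: ifP; rewrite ?muln1 ?muln0 ?add1n.
Qed.

Hypotheses (cG : cubic G) (pM : perfect_matching M).

Lemma degree_add_cubic (x : vert K) : degree x = t + 3.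
Proof. by rewrite degree_add cG pM muln1 addnC. Qed.

Lemma max_degree_add (x : vert G) : max_degree K = t + 3.
Proof.
apply/eqP; rewrite eqn_leq; apply/andP; split.
  by apply/bigmax_leqP => y _; rewrite degree_add_cubic.
by rewrite -(degree_add_cubic x) (leq_bigmax (x : vert K)).
Qed.

(** Degree t + 3 makes all t + 3 colours appear at each vertex, so every colour class is a perfect
    matching of G + tM and projects to one of [G]. *)
Lemma colourable_good : edge_colourable K (t + 3) ->
  exists s : edge G -> {set 'I_(t + 3)}, good M s.
Proof.
case/existsP=> c /forallP cP.
have cI f f' x : x \in ends f -> x \in ends f' -> c f = c f' -> f = f'.
  move=> xf xf'; apply: contra_eq => nff'; have /forallP/(_ f') := cP f.
  by rewrite nff' /=; move/implyP; apply; apply/pred0Pn; exists x; apply/andP.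
exists (fun e => c @: [set f : edge K | base_edge f == e]); split => // [e|a x].
  rewrite -card_copies card_in_imset // => f f'; rewrite !inE => /eqP fe /eqP fe'.
  by have [x _ E] := ends_ex e; apply: (cI _ _ x.1);
    rewrite ends_base ?fe ?fe' E !inE eqxx.
have : a \in c @: [set f : edge K | x \in ends f].
  set B := (X in _ @: X); suff -> : c @: B = setT by [].
  apply/eqP; rewrite eqEcard subsetT cardsT card_ord card_in_imset.
    by rewrite -(degree_add_cubic x) /degree /deg; apply: subset_leq_card;
      apply/subsetP => f; rewrite !inE.
  by move=> f f'; rewrite !inE; apply: cI.
case/imsetP=> f; rewrite inE => xf af; apply/eqP/cards1P; exists (base_edge f).
apply/setP => e; rewrite !inE; apply/andP/eqP => [[/imsetP[f']]|->].
  rewrite inE => /eqP <- af' xf'; congr base_edge; apply: (cI _ _ x) => //.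
    by rewrite ends_base.
  by rewrite -af.
by rewrite -ends_base; split => //; apply/imsetP; exists f; rewrite ?inE.
Qed.

(** The copies of [e] take the elements of [s e], one each. Copies of one edge differ because an
    enumeration has no repetition, copies of distinct adjacent edges because colour classes are
    matchings; degree t + 3 excludes fewer colours. *)
Lemma good_class1 (x : vert G) (s : edge G -> {set 'I_(t + 3)}) : good M s -> class1 K.
Proof.
case=> _ sz pN.
(* [a0] is only the default of [nth]; by [idx] the index stays inside the list. *)
have a0 : 'I_(t + 3) by apply: (@Ordinal _ t); lia.
pose c := [ffun f : edge K => nth a0 (enum (s (base_edge f))) (copy_index f)].
have idx f : copy_index f < size (enum (s (base_edge f))) by rewrite -cardE sz copy_lt.
have cs f : c f \in s (base_edge f) by rewrite ffunE -mem_enum mem_nth.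
have colK : edge_colourable K (t + 3).
  apply/existsP; exists c; apply/forallP => f; apply/forallP => f'; apply/implyP.
  case/andP => nff' /pred0Pn[y /andP[]] /=; rewrite -!/(ends _) => yf yf'.
  apply: contra nff' => /eqP cff'.
  have E : base_edge f = base_edge f'.
    apply: (@pm_inj G _ y _ _ (pN (c f))); rewrite ?inE ?cs -?ends_base //.
    by rewrite cff' cs.
  apply/eqP/copy_inj => //; apply/eqP; move: cff'; rewrite !ffunE E => /eqP.
  by rewrite nth_uniq ?enum_uniq // -?E ?idx // E idx.
rewrite /class1 (max_degree_add x) /chromatic_index; case: ex_minnP => k colk mink.
by rewrite eqn_leq mink //= -(degree_add_cubic (x : vert K)); apply: degree_le_colours.
Qed.

End AddMatching.

(** The vertex [x] serves [max_degree_add]: in a graph without vertices the maximum degree would be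
    0 rather than t + 3. *)
Lemma frumious_not_good (G : mgraph) (x : vert G) t (M : {set edge G})
    (s : edge G -> {set 'I_(t + 3)}) : frumious G -> ~ good M s.
Proof.
case=> cG _ nM gs; have pM : perfect_matching M by case: gs.
have := nM M pM; rewrite /l_index; case: pselect => // [[]]; exists t.
exact: good_class1 gs.
Qed.

Lemma not_good_frumious (G : mgraph) (x : vert G) : cubic G -> bridgeless G ->
  (forall t (M : {set edge G}) (s : edge G -> {set 'I_(t + 3)}), ~ good M s) ->
  frumious G.
Proof.
move=> cG bG nG; split=> // M pM; rewrite /l_index; case: pselect => // ex; exfalso; case: ex => t.
rewrite /class1 (max_degree_add _ cG pM x) => /eqP.
rewrite /chromatic_index; case: ex_minnP => k colk _ kE; move: colk; rewrite kE.
by case/(colourable_good cG pM) => s gs; case: (nG t M s).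
Qed.

(** Preimages under [g] preserve degrees, hence perfect matchings, so a good colouring of [G'] would
    pull back to one of [G]. *)
Lemma isomorphic_frumious (G G' : mgraph) (x : vert G) :
  isomorphic G G' -> frumious G -> frumious G'.
Proof.
case=> f [g [bf bg E]] frG; have [cG bG _] := frG.
have [f' fK f'K] := bf; have [g' gK g'K] := bg.
have degI (F : {set edge G'}) y : deg F (f y) = deg (g @^-1: F) y.
  rewrite !degE (reindex g) /=; last by exists g'; move=> z _.
  by apply: eq_big => e; rewrite ?inE // E mem_imset //; apply: bij_inj.
have adjI (F : {set edge G}) (F' : {set edge G'}) y z : F \subset g @^-1: F' ->
    connect (adj F) y z -> connect (adj F') (f y) (f z).
  move=> /subsetP sF /connectP[p]; elim: p y => [|w p IH] y /=.
    by move=> _ ->; apply: connect0.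
  case/andP=> /adjP[e eF Ee] pp zE; apply: connect_trans (IH w pp zE).
  apply/connect1/(adjI (e := g e)); first by have := sF e eF; rewrite inE.
  by rewrite E Ee imsetU !imset_set1.
have con (F : {set edge G}) (F' : {set edge G'}) :
    F \subset g @^-1: F' -> connected F -> connected F'.
  by move=> sF cF y z; rewrite -(f'K y) -(f'K z); apply: adjI sF _.
apply: (@not_good_frumious _ (f x)) => [y||t M s [pM sz pN]].
- by rewrite -(f'K y) /degree degI preimsetT; apply: cG.
- case: bG => cT cE; split; first by apply: con cT; rewrite preimsetT.
  move=> e; apply: con (cE (g' e)); apply/subsetP => e1; rewrite !inE.
  by apply: contra => /eqP <-; rewrite gK.
have prePM F : perfect_matching F -> perfect_matching (g @^-1: F).
  by move=> pF y; rewrite -degI.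
apply: (@frumious_not_good _ x t (g @^-1: M) (s \o g)) => //; split.
- exact: prePM.
- by move=> e; rewrite /= sz inE.
move=> c; have := prePM _ (pN c); congr perfect_matching.
by apply/setP => e; rewrite !inE.
Qed.

(** * Spanning trees *)

Section Trees.
Variable G : mgraph.
Implicit Types (F C T : {set edge G}) (x y z : vert G) (e f : edge G).

Lemma degU1 F e x : e \notin F -> deg (e |: F) x = (x \in ends e) + deg F x.
Proof.
move=> eF; rewrite /deg; set B := [set f in F | _].
have eB : e \notin B by rewrite inE (negbTE eF).
have -> : [set f in e |: F | x \in ends f] = if x \in ends e then e |: B else B.
  apply/setP => f; rewrite !inE; have [->|nfe] := eqVneq f e.
    by case: ifP => xe; rewrite !inE ?eqxx //= (negbTE eF).
  by case: ifP => xe; rewrite !inE ?(negbTE nfe).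
by case: ifP; rewrite ?cardsU1 ?eB.
Qed.

(** The degree identity means 2 inside the path and 1 at its ends; the additive form avoids
    subtraction and covers the one-vertex path, where both end terms fall on [x]. *)
Lemma path_edges F x p : path (adj F) x p -> uniq (x :: p) ->
  exists D : {set edge G}, [/\ D \subset F,
    forall e, e \in D -> {subset ends e <= x :: p},
    forall v, deg D v + (v == x) + (v == last x p) = (v \in x :: p).*2 &
    forall v, v \in x :: p -> connect (adj D) x v].
Proof.
elim: p x => [|z p IH] x /=.
  move=> _ _; exists set0; split=> [|e|v|v]; rewrite ?sub0set ?inE //.
    rewrite -addnA addnn degE big1 ?add0n // => e _; by rewrite inE.
  by move=> /eqP->; apply: connect0.
case/andP=> /adjP[e eF E] pp /andP[xp up]; have [D [DF DE Dd Dc]] := IH z pp up.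
have eD : e \notin D by apply: contra xp => /DE; apply; rewrite E !inE eqxx.
have xz : x != z by apply: contraNneq xp => ->; rewrite inE eqxx.
exists (e |: D); split=> [|f|v|v].
- by rewrite subUset sub1set eF.
- rewrite inE in_set1 => /orP[/eqP->|/DE fs] w; last by move/fs => wp; rewrite in_cons wp orbT.
  by rewrite E !inE => /orP[]->; rewrite ?orbT.
- rewrite degU1 // E in_set2 [in RHS]inE.
  have := Dd v; have [->|vx] := eqVneq v x.
    by rewrite (negbTE xp) (negbTE xz) /=; lia.
  by rewrite /=; lia.
rewrite inE => /predU1P[->|vp]; first exact: connect0.
apply: connect_trans (connect_adjS (subsetUr _ _) (Dc v vp)).
by apply/connect1/(adjI (e := e)); rewrite ?setU11.
Qed.

(** A simple path joining the ends of [e] in T minus [e] would close up with [e] to a circuit inside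
    [T]. *)
Lemma bridge T e x y : (forall C, C \subset T -> ~ circuit C) ->
  e \in T -> ends e = [set x; y] -> ~~ connect (adj (T :\ e)) x y.
Proof.
move=> aT eT E; apply/negP => /connectP[p0 p0p yE]; subst y.
case/shortenP: p0p E => p pp up _ E {p0}.
have [D [DT _ Dd Dc]] := path_edges pp up.
have eD : e \notin D by apply/negP => /(subsetP DT); rewrite !inE eqxx.
have dC v : deg (e |: D) v = (v \in x :: p).*2.
  rewrite degU1 // -Dd E in_set2; have := card_ends e; rewrite E cards2.
  by have [->|] := eqVneq v x; case: (eqVneq x (last x p)) => //= _ _; lia.
have mono : {subset D <= e |: D} by move=> f fD; rewrite inE fD orbT.
apply: (aT (e |: D)).
  by rewrite subUset sub1set eT (subset_trans DT) // subsetDl.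
split=> [|v|v w]; first by apply/set0Pn; exists e; rewrite setU11.
  by rewrite dC; case: (_ \in _).
rewrite !dC; case vp: (v \in _) => // _; case wp: (w \in _) => // _.
have cx u : u \in x :: p -> connect (adj (e |: D)) x u.
  by move=> up'; apply: connect_adjS (Dc u up'); apply/subsetP.
by apply: connect_trans (cx w wp); rewrite connect_adj_sym; apply: cx.
Qed.

(** [h v] is the length of a shortest walk from [r] to [v]; the last edge of such a walk leads back
    to a closer vertex. *)
Lemma distance F (r : vert G) : connected F -> exists h : vert G -> nat,
  forall v, v != r -> exists e u, [/\ e \in F, ends e = [set v; u] & h u < h v].
Proof.
move=> cF; pose P v n := [exists p : n.-tuple (vert G), path (adj F) r p && (last r p == v)].
have exP v : exists n, P v n.
  have /connectP[p pp ->] := cF r v; exists (size p).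
  by apply/existsP; exists (in_tuple p); rewrite /= pp eqxx.
exists (fun v => ex_minn (exP v)) => v vr.
case: (ex_minnP (exP v)) => n /existsP[[/= p /eqP sp] /andP[pp /eqP lp]] _.
case/lastP: p sp pp lp => [|p w]; first by move=> _ _ /= rv; rewrite rv eqxx in vr.
rewrite size_rcons rcons_path last_rcons => <- /andP[pp /adjP[e eF E]] <-.
exists e, (last r p); split=> //; first by rewrite E setUC.
case: ex_minnP => m _; apply; apply/existsP; exists (in_tuple p).
by rewrite /= pp eqxx.
Qed.

Lemma parent_edges F (r : vert G) : connected F ->
  exists (h : vert G -> nat) (up : {v | v != r} -> edge G), forall v,
    up v \in F /\ exists2 u, ends (up v) = [set sval v; u] & h u < h (sval v).
Proof.
move=> cF; have [h hP] := distance r cF; exists h.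
suff /choice[up upP] : forall v : {v | v != r}, exists e, e \in F /\
  exists2 u, ends e = [set sval v; u] & h u < h (sval v) by exists up.
case=> v vr; by have [e [u [eF E hu]]] := hP v vr; exists e; split=> //; exists u.
Qed.

(** The choice of parent edges is injective: two vertices sharing one would each be closer to the
    root than the other. *)
Lemma card_connected F : connected F -> #|vert G| <= #|F|.+1.
Proof.
move=> cF; have [->//|/card_gt0P[r _]] := posnP #|vert G|.
have [h [up upP]] := parent_edges r cF.
have upI : injective up.
  move=> v w E; have [_ [u Ev hu]] := upP v; have [_ [u' Ew hu']] := upP w.
  apply: val_inj => /=; apply/eqP; apply: contraFT (ltnn (h (sval v))) => nvw.
  have : sval w \in ends (up v) by rewrite E Ew !inE eqxx.
  have : sval v \in ends (up w) by rewrite -E Ev !inE eqxx.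
  rewrite Ev Ew !inE => /orP[vw|/eqP vE]; first by rewrite vw in nvw.
  move=> /orP[|/eqP wE]; first by rewrite eq_sym => wv; rewrite wv in nvw.
  by rewrite [X in h X < _]vE; apply: ltn_trans hu' _; rewrite wE.
rewrite (cardD1 r) inE add1n ltnS.
have -> : #|[predD1 vert G & r]| = #|{: {v | v != r}}|.
  by rewrite card_sig; apply: eq_card => v; rewrite !inE andbT.
rewrite -(card_codom upI); apply: subset_leq_card; apply/subsetP => e /codomP[v ->].
by case: (upP v).
Qed.

(** In a rooted tree at most one edge at [z] leads towards the root, so of two edges at [z] one
    leads away from it. *)
Lemma tree_climb T (r : vert G) : spanning_tree T ->
  exists h : vert G -> nat, forall z e e', e \in T -> e' \in T -> e != e' ->
    z \in ends e -> z \in ends e' ->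
    exists f u, [/\ f \in [set e; e'], ends f = [set z; u] & h z < h u].
Proof.
case=> cT aT; have [h [up upP]] := parent_edges r cT; exists h.
(* Parent edges alone lead every vertex to the root, so an edge of another kind could be removed
   without disconnecting its ends, against [bridge]. *)
have upS e : e \in T -> exists v, e = up v.
  move=> eT; apply: contrapT => nE.
  have con v : connect (adj (T :\ e)) v r.
    have [n] := ubnP (h v); elim: n => // n IH in v *; rewrite ltnS => hv.
    have [->|vr] := eqVneq v r; first exact: connect0.
    have [upT [u E hu]] := upP (exist _ v vr).
    apply: connect_trans (IH u (leq_trans hu hv)).
    apply/connect1/(adjI (e := up (exist _ v vr))) => //.
    by rewrite !inE upT andbT; apply: contra_notN nE => /eqP <-; eexists.
  have [[x y] /= _ E] := ends_ex e.
  have := bridge aT eT E; rewrite (connect_trans (con x)) //.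
  by rewrite connect_adj_sym.
have climb z e v : z \in ends e -> e = up v -> z != sval v ->
    exists u, ends e = [set z; u] /\ h z < h u.
  move=> ze eE zv; have [_ [u E hu]] := upP v; move: ze; rewrite eE E in_set2.
  by rewrite (negbTE zv) /= => /eqP->; exists (sval v); rewrite setUC.
move=> z e e' eT e'T nee' ze ze'.
have [v vE] := upS e eT; have [v' v'E] := upS e' e'T.
have [zv|zv] := eqVneq z (sval v); last first.
  by have [u [E hu]] := climb z e v ze vE zv; exists e, u; rewrite set21.
have [u [E hu]] : exists u, ends e' = [set z; u] /\ h z < h u.
  apply: (climb z e' v' ze' v'E); apply: contra nee' => /eqP zv'.
  by rewrite vE v'E; apply/eqP; congr up; apply: val_inj; rewrite /= -zv zv'.
by exists e', u; rewrite set22.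
Qed.

(* A vertex of maximal height among those reachable without [e] is a leaf. *)
Lemma reach_leaf T e x : spanning_tree T ->
  (forall v, deg T v = 1 \/ 2 < deg T v) ->
  exists2 y, deg T y == 1 & connect (adj (T :\ e)) x y.
Proof.
move=> sT degT; have [h hP] := tree_climb x sT.
case: (@arg_maxnP _ x (connect (adj (T :\ e)) x) h (connect0 _ _)) => z xz zmax.
exists z => //; apply/eqP; have [//|dz] := degT z; exfalso.
have /card_gt1P[f [f' [+ + nff']]] : 1 < #|[set f in T | z \in ends f] :\ e|.
  by have := cardsD1 e [set f in T | z \in ends f]; rewrite -/(deg T z); lia.
rewrite !inE => /and3P[fe fT zf] /and3P[f'e f'T zf'].
have [g [u [gE E hu]]] := hP z f f' fT f'T nff' zf zf'.
have gT : g \in T :\ e by move: gE; rewrite !inE => /orP[]/eqP->; apply/andP.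
have /zmax : connect (adj (T :\ e)) x u.
  by apply: connect_trans xz (connect1 _); apply: adjI gT E.
by rewrite /= leqNgt hu.
Qed.

End Trees.

(** * Faces of a Halin graph *)

Section Darts.
Variables (G : mgraph) (P : plane_embedding G).
Implicit Types (d : dart G) (X : {set vert G}).
Local Notation o := (opp P).
Local Notation r := (rot P).

Definition face_perm : {perm dart G} := (opp P * rot P)%g.
Local Notation phi := face_perm.

Lemma face_permE d : phi d = r (o d). Proof. by rewrite permM. Qed.

Lemma dart_eq d d' : dvert d = dvert d' -> dedge d = dedge d' -> d = d'.
Proof.
by case: d d' => -[x e] xe [[x' e'] xe']; rewrite /dvert /dedge /= => Ev E;
  apply: val_inj; rewrite /= E Ev.
Qed.

Lemma dvert_ends d : dvert d \in ends (dedge d). Proof. exact: (valP d). Qed.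

Lemma dedge_opp d : dedge (o d) = dedge d. Proof. by case: (oppP P d). Qed.

Lemma dvert_opp d : dvert d != dvert (o d).
Proof. by apply/eqP => E; case: (oppP P d) => _; rewrite E. Qed.

Lemma ends_dart d : ends (dedge d) = [set dvert d; dvert (o d)].
Proof.
apply/eqP; rewrite eq_sym eqEcard card_ends cards2 dvert_opp andbT.
by rewrite subUset !sub1set dvert_ends -dedge_opp dvert_ends.
Qed.

Lemma crosses_dart X d : crosses X (dedge d) = (dvert d \in X) (+) (dvert (o d) \in X).
Proof. by rewrite (crossesE _ (dvert_opp d) (ends_dart d)). Qed.

Lemma same_edge d d' : dedge d' = dedge d -> d' = d \/ d' = o d.
Proof.
move=> E; have := dvert_ends d'; rewrite E ends_dart !inE => /orP[]/eqP vE.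
  by left; apply: dart_eq.
by right; apply: dart_eq; rewrite ?dedge_opp.
Qed.

Lemma opp_dartK d : o (o d) = d.
Proof.
have [//|//|E] := @same_edge d (o (o d)); first by rewrite !dedge_opp.
by have := dvert_opp (o d); rewrite E eqxx.
Qed.

Lemma dvert_rot d : dvert (r d) = dvert d.
Proof. by apply/eqP; rewrite -(rotP P) (mem_porbit _ 1). Qed.

Lemma dvert_face d : dvert (phi d) = dvert (o d).
Proof. by rewrite face_permE dvert_rot. Qed.

(* A closed walk leaves [X] as often as it enters [X]. *)
Lemma cross_back X d : crosses X (dedge d) ->
  exists d', [/\ d' \in porbit phi d, crosses X (dedge d') &
                 (dvert d' \in X) = (dvert d \notin X)].
Proof.
rewrite crosses_dart => cr; apply: contrapT => no.
have stay n : (dvert ((phi ^+ n)%g (phi d)) \in X) = (dvert d \notin X).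
  elim: n => [|n IH].
    by rewrite expg0 perm1 dvert_face; move: cr; case: (dvert d \in X); case: (_ \in X).
  rewrite expgSr permM; set d1 := (phi ^+ n)%g (phi d) in IH *.
  rewrite dvert_face; apply: contra_notP no => /eqP nE; exists d1; split=> //.
    by rewrite /d1 -permM -expgS mem_porbit.
  by rewrite crosses_dart IH; move: nE; case: (dvert d \in X); case: (_ \in X).
have /porbitP[n E] : d \in porbit phi (phi d) by rewrite porbit_sym (mem_porbit _ 1).
by have := stay n; rewrite -E; case: (_ \in X).
Qed.

End Darts.

Section Halin.
Variable H : halin.
Hypothesis cH : cubic H.
Implicit Types (d : dart H) (X : {set vert H}) (e : edge H).
Local Notation o := (opp (hplane H)).
Local Notation r := (rot (hplane H)).
Local Notation phi := (face_perm (hplane H)).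
Local Notation T := (htree H).
Local Notation K := (hcirc H).
Local Notation outer := (outer_face (hplane H)).

Lemma circE e : (e \in K) = (e \notin T).
Proof.
have := in_set0 e; have := in_setT e; rewrite -(htreeUcirc H) -(htreeIcirc H) !inE.
by case: (e \in T); case: (e \in K).
Qed.

Lemma outer_circ d : d \in outer -> dedge d \in K.
Proof. by move=> dO; rewrite -houter imset_f. Qed.

Lemma circ_dart d : dedge d \in K -> d \in outer \/ o d \in outer.
Proof.
rewrite -houter => /imsetP[d' d'O E].
by have [<-|<-] := same_edge (hplane H) (esym E); [left|right].
Qed.

Lemma outer_opp d : d \in outer -> o d \notin outer.
Proof.
move=> dO; apply/negP => odO; have := dvert_opp (hplane H) d.
by rewrite (houter_inj odO dO (dedge_opp _ _)) eqxx.
Qed.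

Lemma outer_stable d d' : d' \in porbit phi d -> (d' \in outer) = (d \in outer).
Proof. by rewrite -!eq_porbit_mem => /eqP ->. Qed.

Lemma outer_face_perm d : (phi d \in outer) = (d \in outer).
Proof. exact: outer_stable (mem_porbit phi 1 d). Qed.

Lemma deg_tree_circ x : deg T x + deg K x = 3.
Proof.
rewrite -[RHS](cH x) /degree !degE -big_split /=; apply: eq_bigr => e _.
by rewrite circE inE; case: (e \in T).
Qed.

Lemma deg_tree x : deg T x = 1 \/ deg T x = 3.
Proof.
have := deg_tree_circ x; have := hcirc_leaves x; case: (hcircP H) => _ /(_ x) + _.
by case/orP => /eqP -> /=; have [->|] := eqVneq (deg T x) 1; lia.
Qed.

Lemma deg_circ_leaf x : deg T x = 1 -> deg K x = 2.
Proof. by have := deg_tree_circ x; lia. Qed.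

(** Two leaves joined by a tree edge would form a component of the tree, which has more than three
    vertices. *)
Lemma leaves_not_adjacent e x y : e \in T -> ends e = [set x; y] ->
  deg T x = 1 -> deg T y != 1.
Proof.
move=> eT E dx; apply/eqP => dy.
have only z f : deg T z = 1 -> z \in ends e -> f \in T -> z \in ends f -> f = e.
  move=> /eqP/cards1P[g gE] ze fT zf.
  have : f \in [set g] by rewrite -gE inE fT.
  have : e \in [set g] by rewrite -gE inE eT.
  by rewrite !inE => /eqP-> /eqP->.
have /subset_leq_card : [set: vert H] \subset [set x; y].
  apply/subsetP => z _; have [cT _] := htreeP H.
  have /connectP[p pp ->] := cT x z.
  have stay q v : path (adj T) v q -> v \in [set x; y] -> last v q \in [set x; y].
    elim: q v => [|w q IH] v //= /andP[/adjP[f fT fE] pq] vxy.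
    apply: IH pq _; rewrite -E -(only v f) ?fE ?set22 ?set21 ?E //.
    by move: vxy; rewrite !inE => /orP[]/eqP->.
  by apply: stay pp _; rewrite set21.
by rewrite cardsT cards2; have := htree_size H; case: (x == y) => /=; lia.
Qed.

(** The outer face leaves a vertex as often as it enters it, each time along a different circuit
    edge; a leaf has only two of these, so it is left only once. *)
Lemma outer_tail_inj : {in outer &, injective (@dvert H)}.
Proof.
move=> d d' dO d'O vE; have dl := circ_dart_leaf (outer_circ dO).
set x := dvert d in vE dl.
pose D1 := [set k in outer | dvert k == x].
pose D2 := [set k in outer | dvert (o k) == x].
have D12 : #|D1| = #|D2|.
  rewrite -(card_imset D2 (@perm_inj _ phi)); congr #|pred_of_set _|; apply/setP => k.
  apply/idP/imsetP => [kD|[k' + ->]]; last by rewrite !inE outer_face_perm dvert_face.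
  exists ((phi^-1)%g k); last by rewrite permKV.
  by move: kD; rewrite !inE -{1 2}[k](permKV phi) outer_face_perm dvert_face.
have sub : (@dedge H) @: (D1 :|: D2) \subset [set e in K | x \in ends e].
  apply/subsetP => e /imsetP[k + ->]; rewrite !inE => kD.
  have kO : k \in outer by move: kD => /orP[]/andP[].
  rewrite outer_circ //= (ends_dart (hplane H)) !inE.
  by case/orP: kD => /andP[_ /eqP->]; rewrite eqxx ?orbT.
have := subset_leq_card sub; rewrite -/(deg K x) (deg_circ_leaf (eqP dl)).
rewrite card_in_imset; last first.
  by move=> k k'; rewrite !inE => kD k'D; apply: houter_inj;
    [case/orP: kD => /andP[]|case/orP: k'D => /andP[]].
rewrite cardsU (_ : D1 :&: D2 = set0) ?cards0; last first.
  apply/setP => k; rewrite !inE; apply/negP => /andP[/andP[_ /eqP E1] /andP[_ /eqP E2]].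
  by have := dvert_opp (hplane H) k; rewrite E1 E2 eqxx.
rewrite -D12 subn0 addnn -[2]/(1.*2) leq_double => /card_le1_eqP; apply.
  by apply/setIdP; split=> //; rewrite -vE.
by apply/setIdP; split.
Qed.

Definition side e x := [set v | connect (adj (T :\ e)) x v].

(** This is the fundamental cut of [e]: by [bridge] it separates the ends of [e], while the ends of
    any other tree edge stay connected without [e]. *)
Lemma crosses_side e x f : e \in T -> x \in ends e -> f \in T ->
  crosses (side e x) f = (f == e).
Proof.
move=> eT xe fT; have [[a b] /= ab E] := ends_ex f.
rewrite (crossesE _ ab E) !inE; have [fe|nfe] := eqVneq f e.
  subst f; have [y xy Ey] := ends2 xe.
  have nxy : connect (adj (T :\ e)) x y = false.
    by apply/negbTE; apply: bridge Ey => //; case: (htreeP H).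
  have := xe; have : y \in ends e by rewrite Ey set22.
  rewrite E !inE => /orP[]/eqP yE /orP[]/eqP xE; move: xy nxy; rewrite yE xE ?eqxx //.
    by move=> _ ->; rewrite connect0.
  by move=> _ ->; rewrite connect0.
apply/negbTE; rewrite -[connect _ x b](same_connect_r (connect_adj_sym _) (_ : connect _ a b)) ?addbb //.
by apply/connect1/(adjI (e := f)); rewrite // !inE nfe.
Qed.

(** On a face without circuit edges, [cross_back] applied to the fundamental cut of a traversed edge
    forces a return through that same edge. The face is then closed under reversal, hence under
    rotation, and by connectivity contains all darts, even the outer ones. *)
Lemma inner_exists d : d \notin outer -> exists2 k, k \in outer & o k \in porbit phi d.
Proof.
move=> dO; apply: contrapT => no.
have allT d1 : d1 \in porbit phi d -> dedge d1 \in T.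
  move=> d1d; rewrite -[_ \in T]negbK -circE; apply/negP => /circ_dart[d1O|od1O].
    by case/negP: dO; rewrite -(outer_stable d1d).
  by apply: no; exists (o d1); rewrite ?opp_dartK.
have oppC d1 : d1 \in porbit phi d -> o d1 \in porbit phi d.
  move=> d1d; have eT := allT _ d1d; have xe := dvert_ends d1.
  have [|d2 [d2d c2 nd2]] := @cross_back _ (hplane H) (side (dedge d1) (dvert d1)) d1.
    by rewrite crosses_side.
  have E1 : porbit phi d1 = porbit phi d by apply/eqP; rewrite eq_porbit_mem.
  rewrite E1 in d2d; move: c2; rewrite crosses_side ?(allT d2) // => /eqP E.
  have [d21|<-//] := same_edge (hplane H) E.
  by move: nd2; rewrite d21; case: (_ \in side _ _).
have faceC d1 : d1 \in porbit phi d -> phi d1 \in porbit phi d.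
  by rewrite -!eq_porbit_mem (porbit_perm phi 1).
have rotC d1 d2 : dvert d2 = dvert d1 -> d1 \in porbit phi d -> d2 \in porbit phi d.
  move=> /eqP; rewrite -(rotP (hplane H)) => /porbitP[n ->].
  elim: n => [|n IH] d1d; first by rewrite perm1.
  by rewrite expgSr permM -[X in r X](opp_dartK (hplane H)) -face_permE; apply/faceC/oppC/IH.
suff all d1 : d1 \in porbit phi d.
  by case/negP: dO; rewrite /outer_face porbit_sym all.
have pathC q v : path (adj [set: edge H]) v q ->
    (forall d2, dvert d2 = v -> d2 \in porbit phi d) ->
    forall d2, dvert d2 = last v q -> d2 \in porbit phi d.
  elim: q v => [|w q IH] v //= /andP[/adjP[f _ E] pq] vQ; apply: IH pq _ => d2 d2w.
  have vf : v \in ends f by rewrite E set21.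
  pose d3 : dart H := exist _ (v, f) vf.
  have /oppC od3 : d3 \in porbit phi d by apply: vQ.
  apply: rotC od3; rewrite d2w; have := dvert_opp (hplane H) d3.
  have : dvert (o d3) \in ends f by rewrite -[f]/(dedge d3) -(dedge_opp (hplane H)) dvert_ends.
  by rewrite E !inE [dvert d3]/dvert /= => /orP[]/eqP-> //; rewrite eqxx.
have /connectP[p pp pl] := emb_connected (hplane H) (dvert d) (dvert d1).
by apply: pathC pp _ _ pl => d2 d2v; apply: (rotC d); rewrite ?porbit_id.
Qed.

(** Euler's formula with |V| at most |T| + 1 and |E| = |T| + |K| gives at least |K| + 1 faces. *)
Lemma card_faces : #|outer| < #|porbits phi|.
Proof.
have cK : #|outer| = #|K| by rewrite -houter card_in_imset //; apply: houter_inj.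
have cE : #|edge H| = #|T| + #|K|.
  by rewrite -cardsT -(htreeUcirc H) cardsU htreeIcirc cards0 subn0.
have [cT _] := htreeP H; have := card_connected cT; have := euler (hplane H).
by rewrite -/phi cE cK; lia.
Qed.

(** Pigeonhole: by [inner_exists] the faces of the darts [o k] include every face but the outer one,
    and by [card_faces] these are at least as many as the outer darts. *)
Lemma inner_unique k k' : k \in outer -> k' \in outer ->
  o k' \in porbit phi (o k) -> k = k'.
Proof.
move=> kO k'O oo; pose F k := porbit phi (o k).
suff FI : {in outer &, injective F} by apply: FI => //; apply/eqP; rewrite eq_sym eq_porbit_mem.
apply/imset_injP; rewrite eqn_leq leq_imset_card /= -ltnS.
apply: leq_trans card_faces _; rewrite (cardsD1 outer) -add1n leq_add ?leq_b1 //.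
apply/subset_leq_card/subsetP => Q; rewrite 2!inE => /andP[nQ /imsetP[d _ QE]]; subst Q.
have dO : d \notin outer.
  by apply: contra nQ => dO; rewrite /outer_face eq_porbit_mem.
have [k1 k1O k1d] := inner_exists dO; apply/imsetP; exists k1 => //.
by apply/eqP; rewrite eq_porbit_mem porbit_sym.
Qed.

Lemma rot_neq d : r d != d /\ r (r d) != d.
Proof.
have c3 : #|porbit r d| = 3.
  rewrite -(cH (dvert d)) /degree /deg -(card_in_imset (f := @dedge H) (D := porbit r d)).
    congr #|pred_of_set _|; apply/setP => e; rewrite !inE /=.
    apply/imsetP/idP => [[d' + ->]|xe]; first by rewrite rotP => /eqP <-; apply: dvert_ends.
    by exists (exist _ (dvert d, e) xe) => //; rewrite rotP.
  by move=> d1 d2; rewrite !rotP => /eqP E1 /eqP E2; apply: dart_eq; rewrite E1.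
have := uniq_traject_porbit r d; rewrite c3 /= !inE negb_or => /andP[/andP[n1 n2] _].
by rewrite eq_sym n1 eq_sym n2.
Qed.

(** Otherwise some outer dart other than [d] would have the same tail: [r d], or else [r (r d)],
    which follows [o (r d)] on its face. *)
Lemma rot_outer d : d \in outer -> dedge (r d) \in T.
Proof.
move=> dO; rewrite -[_ \in T]negbK -circE; apply/negP => /circ_dart[rO|oO].
  have [/eqP[]] := rot_neq d; apply: outer_tail_inj => //; exact: dvert_rot.
have [_ /eqP[]] := rot_neq d; have <- : phi (o (r d)) = r (r d).
  by rewrite face_permE opp_dartK.
apply: outer_tail_inj; rewrite ?outer_face_perm //.
by rewrite dvert_face opp_dartK dvert_rot.
Qed.

(** [X] is a shore of the fundamental cut of [e2]. Each of the two faces at [e2] must cross this cut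
    again, and an inner face has a single circuit edge to do so: [d] on one side of [e2], [d'] on
    the other. No other inner face crosses it. *)
Lemma face_cut d : d \in outer -> exists e1 e2 X d',
  [/\ [/\ e1 \in T, e2 \in T & e1 != e2],
      dvert d \in ends e1 /\ (exists2 w, w \in ends e1 & w \in ends e2),
      d' \in outer /\ d != d',
      forall e, e \in T -> crosses X e = (e == e2) &
      forall k, k \in outer -> crosses X (dedge k) = (k == d) || (k == d')].
Proof.
(* The inner face at [d] continues after [o d] with the tree edge [d1] of the leaf, and then with
   [d2]. *)
move=> dO; pose d1 := r d; pose d2 := phi d1.
have e1T : dedge d1 \in T := rot_outer dO.
have dx : dvert d = dvert d1 by rewrite dvert_rot.
have dlx : deg T (dvert d1) = 1.
  by rewrite -dx; apply/eqP; apply: circ_dart_leaf; apply: outer_circ.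
have d2x : dvert d2 = dvert (o d1) by rewrite dvert_face.
have ne12 : dedge d1 != dedge d2.
  apply/eqP => E; have [/eqP[]] := rot_neq (o d1); rewrite -face_permE -/d2.
  by apply: (dart_eq d2x); rewrite dedge_opp.
have e2T : dedge d2 \in T.
  rewrite -[_ \in T]negbK -circE; apply/negP => /circ_dart_leaf /eqP; rewrite d2x => dl2.
  by have := leaves_not_adjacent e1T (ends_dart (hplane H) d1) dlx; rewrite dl2.
pose X := side (dedge d2) (dvert d2).
have XT e : e \in T -> crosses X e = (e == dedge d2).
  by move=> eT; rewrite crosses_side ?dvert_ends.
have d2Q : d2 \in porbit phi (o d).
  have : phi (phi (o d)) \in porbit phi (o d).
    by rewrite -eq_porbit_mem !(porbit_perm phi 1).
  by rewrite [phi (o d)]face_permE opp_dartK.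
have od_nO := outer_opp dO.
have tree_nO k : dedge k \in T -> k \notin outer.
  by move=> kT; apply/negP => /outer_circ; rewrite circE kT.
have cross_inner k d3 : k \in outer -> d3 \in porbit phi (o k) -> crosses X (dedge d3) ->
    [\/ d3 = d2, d3 = o d2 | d3 = o k].
  move=> kO d3k; have [d3T|] := boolP (dedge d3 \in T).
    by rewrite XT // => /eqP /(same_edge (hplane H))[]; [constructor 1|constructor 2].
  rewrite -circE => /circ_dart[d3O|d3O] _.
    by move: d3O; rewrite (outer_stable d3k) (negbTE (outer_opp kO)).
  constructor 3; rewrite -[d3](opp_dartK (hplane H)); congr (o _).
  by apply/esym/inner_unique; rewrite ?opp_dartK.
have cross_edge k : crosses X (dedge k) -> exists d3,
    [/\ d3 \in porbit phi k, crosses X (dedge d3) & (dvert d3 \in X) = (dvert k \notin X)].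
  exact: cross_back.
have no_cross k : k \in outer -> d2 \notin porbit phi (o k) ->
    o d2 \notin porbit phi (o k) -> crosses X (dedge k) = false.
  move=> kO nd2 nod2; apply/negP => ck.
  have [|d3 [d3k c3 v3]] := cross_edge (o k); first by rewrite dedge_opp.
  have [E|E|E] := cross_inner k d3 kO d3k c3; first by rewrite E (negbTE nd2) in d3k.
    by rewrite E (negbTE nod2) in d3k.
  by move: v3; rewrite E; case: (_ \in X).
(* If both sides of the edge of [d2] lay on one face, no circuit edge but that of [d] could cross
   the cut, and not this one alone, as the outer face crosses back. The connected circuit would then
   stay in one shore, yet both shores contain leaves. *)
have od2_nQ : o d2 \notin porbit phi (o d).
  apply/negP => od2Q.
  have noK k : k \in outer -> k != d -> crosses X (dedge k) = false.
    move=> kO kd; apply: no_cross => //; apply: contra kd => inQ; apply/eqP;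
      apply: inner_unique => //; rewrite porbit_sym -eq_porbit_mem in inQ.
      by rewrite -eq_porbit_mem eq_sym (eqP inQ) eq_porbit_mem.
    by rewrite -eq_porbit_mem eq_sym (eqP inQ) eq_porbit_mem.
  have noKe e : e \in K -> crosses X e = false.
    rewrite -houter => /imsetP[k kO ->]; have [->|] := eqVneq k d; last exact: noK.
    apply/negP => cd; have [d3 [d3d c3 v3]] := cross_edge d cd.
    have [E|nd] := eqVneq d3 d; first by move: v3; rewrite E; case: (_ \in X).
    by rewrite noK ?(outer_stable d3d) in c3.
  have leafX v : exists2 x, 0 < deg K x & connect (adj (T :\ dedge d2)) v x.
    have [|x dx' vx] := @reach_leaf _ T (dedge d2) v (htreeP H).
      by move=> u; case: (deg_tree u) => ->; [left|right].
    by exists x; rewrite // hcirc_leaves.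
  have [x xK xc] := leafX (dvert d2); have [y yK yc] := leafX (dvert (o d2)).
  have [_ _ /(_ x y xK yK) xy] := hcircP H.
  have : y \in X.
    have : x \in X by rewrite inE.
    have /connectP[p pp ->] := xy; elim: p x {xK xc xy} pp => [|w p IH] x //= /andP[/adjP[f fK E] pp] xX.
    apply: IH pp _; have := noKe f fK.
    have [E2|xw] := eqVneq x w; first by rewrite -E2.
    by rewrite (crossesE _ xw E) xX; case: (w \in X).
  rewrite inE => yX; have [_ aT] := htreeP H.
  have /negP := bridge aT e2T (ends_dart (hplane H) d2); apply.
  by apply: connect_trans yX _; rewrite connect_adj_sym.
have od2_nO : o d2 \notin outer by apply: tree_nO; rewrite dedge_opp.
have [d' d'O d'Q] := inner_exists od2_nO.
have od2Q' : o d2 \in porbit phi (o d') by rewrite porbit_sym.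
have dd' : d != d' by apply: contraNneq od2_nQ => ->.
exists (dedge d1), (dedge d2), X, d'; split=> //.
  split; first by rewrite dx dvert_ends.
  by exists (dvert d2); rewrite ?dvert_ends // d2x -(dedge_opp (hplane H)) dvert_ends.
have same_face k k' d3 : k \in outer -> k' \in outer -> d3 \in porbit phi (o k) ->
    d3 \in porbit phi (o k') -> k = k'.
  move=> kO k'O; rewrite porbit_sym -eq_porbit_mem => /eqP E.
  by rewrite porbit_sym -E => oo; apply: inner_unique.
move=> k kO; have [->|kd] := eqVneq k d.
  apply/esym; have [|d3 [d3Q c3 v3]] := cross_edge d2; first by rewrite XT ?eqxx.
  have E : porbit phi d2 = porbit phi (o d) by apply/eqP; rewrite eq_porbit_mem.
  rewrite E in d3Q; have [E3|E3|E3] := cross_inner d d3 dO d3Q c3.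
  - by move: v3; rewrite E3; case: (_ \in X).
  - by move: d3Q; rewrite E3 (negbTE od2_nQ).
  - by move: c3; rewrite E3 dedge_opp => ->.
have [->|kd'] := eqVneq k d'.
  apply/esym; have [|d3 [d3Q c3 v3]] := cross_edge (o d2); first by rewrite dedge_opp XT ?eqxx.
  have E : porbit phi (o d2) = porbit phi (o d') by apply/eqP; rewrite eq_porbit_mem.
  rewrite E in d3Q; have [E3|E3|E3] := cross_inner d' d3 d'O d3Q c3.
  - by case/eqP: dd'; apply: (same_face _ _ d2); rewrite // -E3.
  - by move: v3; rewrite E3; case: (_ \in X).
  - by move: c3; rewrite E3 dedge_opp => ->.
apply: no_cross => //.
  by apply: contra kd => kQ; apply/eqP; apply: (same_face _ _ d2).
by apply: contra kd' => kQ; apply/eqP; apply: (same_face _ _ (o d2)).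
Qed.

End Halin.

(** * Treelike graphs *)

Section Arcs.
Variable H : halin.
Hypothesis cH : cubic H.
Implicit Types (k : circ_arc H) (x : leaf H).
Local Notation phi := (face_perm (hplane H)).

Fact next_arc_subproof k : phi (val k) \in outer_face (hplane H).
Proof. by rewrite outer_face_perm (valP k). Qed.

Definition next_arc k : circ_arc H := exist _ (phi (val k)) (next_arc_subproof k).

Lemma tail_next k : arc_tail (next_arc k) = arc_head k.
Proof. by apply: val_inj; rewrite /= dvert_face. Qed.

Lemma arc_tail_inj : injective (@arc_tail H).
Proof.
move=> k k' /(congr1 val) /= E; apply: val_inj.
by apply: (outer_tail_inj cH); rewrite ?(valP k) ?(valP k').
Qed.

Lemma next_arc_inj : injective next_arc.
Proof. by move=> k k' /(congr1 val) /= /perm_inj /val_inj. Qed.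

Lemma tail_neq_head k : arc_tail k != arc_head k.
Proof. by rewrite -val_eqE /= dvert_opp. Qed.

(** The arcs form a single orbit of the face permutation, so the successors of [k0] run through all
    of them. *)
Lemma arc_ind (Q : circ_arc H -> Prop) k0 : (forall k, Q k -> Q (next_arc k)) ->
  Q k0 -> forall k, Q k.
Proof.
move=> step Q0 k; have /porbitP[n E] : val k \in porbit phi (val k0).
  rewrite -eq_porbit_mem; move: (valP k) (valP k0).
  by rewrite /outer_face -!eq_porbit_mem => /eqP-> /eqP->.
elim: n k E => [|n IH] k E.
  by rewrite (_ : k = k0) //; apply: val_inj; rewrite E expg0 perm1.
have k1O : (phi ^+ n)%g (val k0) \in outer_face (hplane H).
  by rewrite (outer_stable (mem_porbit phi n (val k0))) (valP k0).
pose k1 : circ_arc H := exist (fun d => d \in outer_face (hplane H)) _ k1O.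
rewrite (_ : k = next_arc k1); first by apply/step/IH.
by apply: val_inj; rewrite /= E expgSr permM.
Qed.

Lemma prev_arc k : exists k', next_arc k' = k.
Proof.
(* The induction starts at [next_arc k], which has a predecessor by construction. *)
by apply: (@arc_ind (fun k => exists k', next_arc k' = k) (next_arc k)) => [k1 _|];
  [exists k1|exists k].
Qed.

Lemma leaf_tail x : exists k, arc_tail k = x.
Proof.
have : 0 < deg (hcirc H) (val x) by rewrite hcirc_leaves (valP x).
case/card_gt0P => e; rewrite inE -houter => /andP[/imsetP[d dO ->]].
pose k : circ_arc H := exist _ d dO.
rewrite (ends_dart (hplane H)) !inE => /orP[]/eqP E; [exists k|exists (next_arc k)].
  by apply: val_inj.
by rewrite tail_next; apply: val_inj.
Qed.

Lemma arc_face_cut k : exists e1 e2 X k',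
  [/\ [/\ e1 \in htree H, e2 \in htree H & e1 != e2],
      val (arc_tail k) \in ends e1 /\ (exists2 w, w \in ends e1 & w \in ends e2),
      k != k',
      forall e, e \in htree H -> crosses X e = (e == e2) &
      forall k1, (val (arc_tail k1) \in X) (+) (val (arc_head k1) \in X)
                 = (k1 == k) || (k1 == k')].
Proof.
have [e1 [e2 [X [d' [? ? [d'O dd'] ? cK]]]]] := face_cut cH (valP k).
exists e1, e2, X, (exist _ d' d'O); split=> // k1.
by have := cK _ (valP k1); rewrite (crosses_dart (hplane H)).
Qed.

End Arcs.

(** * Degrees in the treelike graph *)

Section TreelikeDegrees.
Variables (H : halin) (A : circ_arc H -> fourpole).
Hypothesis cH : cubic H.
Local Notation TG := (treelike_graph A).
Implicit Types (F M : {set edge TG}) (k : circ_arc H) (x : leaf H).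

Definition TreeE (e : {e : edge H | e \in htree H}) : edge TG := inl (inl (inl e)).
Definition LeafE (z : leaf H * bool) : edge TG := inl (inl (inr z)).
Definition PoleE k (p : pole_edge (A k)) : edge TG :=
  inl (inr (Tagged (fun k => pole_edge (A k)) p)).
Definition DangE k (d : bool * bool) : edge TG := inr (k, d).

Local Notation TV := (@TreeV H A).
Local Notation LV := (@LeafV H A).

Lemma TreeV_inj : injective TV. Proof. by move=> x y []. Qed.
Lemma LeafV_inj : injective LV. Proof. by move=> x y []. Qed.
Lemma PoleV_inj k : injective (@PoleV H A k).
Proof. by move=> x y [] /eqP; rewrite eq_Tagged => /eqP. Qed.

Definition arc_end k (s : bool) : leaf H := if s then arc_head k else arc_tail k.

Lemma big_edges (Q : pred (edge TG)) (f : edge TG -> nat) :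
  \sum_(e | Q e) f e =
    \sum_(e | Q (TreeE e)) f (TreeE e) + \sum_(z | Q (LeafE z)) f (LeafE z)
    + \sum_k \sum_(p | Q (@PoleE k p)) f (PoleE p)
    + \sum_k \sum_(d | Q (DangE k d)) f (DangE k d).
Proof.
rewrite !big_sumType /=; congr (_ + _ + _).
  rewrite (sig_big_dep predT (fun k p => Q (@PoleE k p)) (fun k p => f (PoleE p))) /=.
  by apply: eq_big => [[k p]|[k p] _].
rewrite pair_big_dep /=; by apply: eq_big => [[k p]|[k p] _].
Qed.

Lemma TreeV_TreeE v e : (TV v \in ends (TreeE e)) = (v \in ends (val e)).
Proof. by rewrite /= mem_imset //; apply: TreeV_inj. Qed.
Lemma TreeV_PoleE v k (p : pole_edge (A k)) : (TV v \in ends (PoleE p)) = false.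
Proof. by apply/negbTE/imsetP => -[]. Qed.
Lemma LeafV_TreeE z e : (LV z \in ends (TreeE e)) = false.
Proof. by apply/negbTE/imsetP => -[]. Qed.
Lemma LeafV_PoleE z k (p : pole_edge (A k)) : (LV z \in ends (PoleE p)) = false.
Proof. by apply/negbTE/imsetP => -[]. Qed.
Lemma PoleV_TreeE k (y : pole_vert (A k)) e : (PoleV y \in ends (TreeE e)) = false.
Proof. by apply/negbTE/imsetP => -[]. Qed.
Lemma PoleV_PoleE k (y : pole_vert (A k)) (p : pole_edge (A k)) :
  (PoleV y \in ends (PoleE p)) = (y \in pole_ends p).
Proof. by rewrite /= mem_imset //; apply: PoleV_inj. Qed.
Lemma PoleV_PoleE_neq k k' (y : pole_vert (A k)) (p : pole_edge (A k')) :
  k != k' -> (PoleV y \in ends (PoleE p)) = false.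
Proof. by move=> kk'; apply/negbTE/imsetP => -[y' _ [E]]; rewrite E eqxx in kk'. Qed.

Lemma ends_LeafE z : ends (LeafE z) = [set TV (val z.1); LV z]. Proof. by []. Qed.
Lemma ends_DangE k d :
  ends (DangE k d) = [set @PoleV H A k (dangling_end (A k) d); LV (arc_end k d.1, d.2)].
Proof. by case: d. Qed.

Lemma deg_TreeV F v : deg F (TV v) =
  \sum_(e | v \in ends (val e)) (TreeE e \in F : nat)
  + \sum_(z | val z.1 == v) (LeafE z \in F : nat).
Proof.
rewrite degE big_edges [X in _ + X + _]big1 ?addn0; last first.
  by move=> k _; apply: big_pred0 => p; rewrite TreeV_PoleE.
rewrite [X in _ + X]big1 ?addn0; last first.
  by move=> k _; apply: big_pred0 => d; rewrite ends_DangE !inE.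
congr (_ + _); apply: eq_bigl => e; first exact: TreeV_TreeE.
by rewrite ends_LeafE !inE orbF (inj_eq TreeV_inj) eq_sym.
Qed.

(** Each leaf is the head of one arc and the tail of the next, so naming it [arc_head k] identifies
    the two consecutive poles whose dangling edges meet there. *)
Lemma deg_LeafV F k i : deg F (LV (arc_head k, i)) =
  (LeafE (arc_head k, i) \in F) + (DangE k (true, i) \in F) + (DangE (next_arc k) (false, i) \in F).
Proof.
rewrite degE big_edges [X in X + _ + _ + _]big_pred0 ?add0n; last first.
  by move=> e; apply: LeafV_TreeE.
rewrite [X in _ + X + _]big1 ?addn0; last first.
  by move=> k' _; apply: big_pred0 => p; rewrite LeafV_PoleE.
rewrite (big_pred1 (arc_head k, i)); last first.
  by move=> z; rewrite ends_LeafE !inE /= (inj_eq LeafV_inj) eq_sym.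
rewrite -addnA; congr (_ + _).
have kn : next_arc k != k by apply: contra (tail_neq_head k) => /eqP {1}<-; rewrite tail_next.
have dE k' d : (LV (arc_head k, i) \in ends (DangE k' d)) =
    (k' == if d.1 then k else next_arc k) && (d.2 == i).
  rewrite ends_DangE !inE /= (inj_eq LeafV_inj) -pair_eqE /= [_ == d.2]eq_sym; congr (_ && _).
  rewrite eq_sym; case: d.1 => /=; rewrite -tail_next -?tail_next (inj_eq (arc_tail_inj cH)) //.
  by rewrite (inj_eq (@next_arc_inj _)).
rewrite (bigD1 k) //; congr (_ + _).
  rewrite (big_pred1 (true, i)) // => -[s j]; rewrite dE /= xpair_eqE.
  by case: s; rewrite ?eqxx // eq_sym (negbTE kn).
rewrite (bigD1 (next_arc k)) ?kn // -[RHS]addn0; congr (_ + _).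
  rewrite (big_pred1 (false, i)) // => -[s j]; rewrite dE /= xpair_eqE.
  by case: s; rewrite ?eqxx // (negbTE kn).
apply: big1 => k' /andP[k1 k2]; apply: big_pred0 => d; rewrite dE.
by case: d.1; rewrite ?(negbTE k1) ?(negbTE k2).
Qed.

Lemma deg_PoleV F k (y : pole_vert (A k)) : deg F (PoleV y) =
  \sum_(p | y \in pole_ends p) (@PoleE k p \in F : nat)
  + \sum_(d | dangling_end (A k) d == y) (DangE k d \in F : nat).
Proof.
rewrite degE big_edges [X in X + _ + _ + _]big_pred0 ?add0n; last first.
  by move=> e; apply: PoleV_TreeE.
rewrite [X in X + _ + _]big_pred0 ?add0n; last first.
  by move=> z; rewrite ends_LeafE !inE.
have dE k' d : (PoleV y \in ends (DangE k' d)) = (PoleV y == @PoleV H A k' (dangling_end (A k') d)).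
  by rewrite ends_DangE !inE orbF.
congr (_ + _); rewrite (bigD1 k) //= [X in _ + X]big1 ?addn0; last first.
- move=> k' k'k; apply: big_pred0 => d; rewrite dE; apply/negbTE.
  by apply: contra k'k => /eqP[E _]; rewrite E.
- by apply: eq_bigl => d; rewrite dE (inj_eq (@PoleV_inj k)) eq_sym.
- by move=> k' k'k; apply: big_pred0 => p; rewrite PoleV_PoleE_neq // eq_sym.
by apply: eq_bigl => p; rewrite PoleV_PoleE.
Qed.

End TreelikeDegrees.

Lemma sum_option (I : finType) (Q : pred (option I)) (f : option I -> nat) :
  \sum_(a | Q a) f a = (if Q None then f None else 0) + \sum_(i | Q (Some i)) f (Some i).
Proof.
rewrite big_mkcond (bigD1 None) //=; congr (_ + _).
rewrite [RHS]big_mkcond (reindex_omap Some id) /=; last by case.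
by apply: eq_bigl => i; rewrite eqxx.
Qed.

Lemma sum_bool2 (Q : pred (bool * bool)) (f : bool * bool -> nat) :
  \sum_(d | Q d) f d = \sum_s \sum_(i | Q (s, i)) f (s, i).
Proof. by rewrite pair_big_dep /=; apply: eq_big => -[]. Qed.

(** * Degrees in the closure of a pole *)

Section Closure.
Variable B : fourpole.
Local Notation CG := (pole_closure B).

Lemma deg_closure_pole (F : {set edge CG}) (y : pole_vert B) :
  deg F (inl y : vert CG) = \sum_(p | y \in pole_ends p) ((inl p : edge CG) \in F : nat)
    + \sum_(d | dangling_end B d == y) ((inr (Some d) : edge CG) \in F : nat).
Proof.
rewrite degE big_sumType /= sum_option /= !inE add0n; congr (_ + _).
  by apply: eq_bigl => p; rewrite mem_imset // => a b [].
by apply: eq_bigl => d; rewrite !inE /= eq_sym.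
Qed.

Lemma deg_closure_new (F : {set edge CG}) s : deg F (inr s : vert CG) =
  ((inr None : edge CG) \in F) + ((inr (Some (s, false)) : edge CG) \in F)
  + ((inr (Some (s, true)) : edge CG) \in F).
Proof.
rewrite degE big_sumType /= big_pred0 ?add0n; last by move=> p; apply/negbTE/imsetP => -[].
rewrite sum_option /=; have -> : (inr s : vert CG) \in [set inr false; inr true].
  by rewrite !inE; case: s.
rewrite -addnA; congr (_ + _).
rewrite sum_bool2 (bigD1 s) // -[RHS]addn0; congr (_ + _).
  rewrite (eq_bigl predT) => [|i]; last by rewrite /= !inE eqxx.
  by rewrite big_bool addnC.
apply: big1 => s' s's; apply: big_pred0 => i.
by rewrite /= !inE orbF; apply: contraNF s's => /eqP[->].
Qed.

End Closure.

(** * Parity of cuts in the treelike graph *)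

Section TreelikeCuts.
Variables (H : halin) (A : circ_arc H -> fourpole).
Hypothesis cH : cubic H.
Hypothesis fA : forall k, frumious_pole (A k).
Local Notation TG := (treelike_graph A).
Implicit Types (F M : {set edge TG}) (k : circ_arc H).

Lemma sum_leaf (x : leaf H) (f : leaf H * bool -> nat) :
  \sum_(z | val z.1 == val x) f z = f (x, false) + f (x, true).
Proof.
transitivity (\sum_(y | val y == val x) \sum_i f (y, i)).
  by rewrite pair_big /=; apply: eq_big => [[y i]|[y i] _] //=; rewrite andbT.
under eq_bigl => y do rewrite (inj_eq val_inj).
by rewrite big_pred1_eq big_bool addnC.
Qed.

Lemma deg_TreeV_leaf F (x : leaf H) (e : {e | e \in htree H}) : val x \in ends (val e) ->
  deg F (TreeV A (val x)) =
    (TreeE A e \in F) + (LeafE A (x, false) \in F) + (LeafE A (x, true) \in F).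
Proof.
move=> xe; rewrite deg_TreeV sum_leaf addnA; congr (_ + _ + _).
rewrite (big_pred1 e) // => e'; apply/idP/eqP => [xe'|-> //].
have /cards1P[g gE] := valP x; apply: val_inj.
have : val e \in [set g] by rewrite -gE inE xe (valP e).
have : val e' \in [set g] by rewrite -gE inE xe' (valP e').
by rewrite !inE => /eqP-> /eqP->.
Qed.

Lemma treelike_cubic : cubic TG.
Proof.
case=> [[v|[x i]]|[k y]]; rewrite /degree.
- have [dv|dv] := deg_tree cH v.
    have xl : deg (htree H) v == 1 by rewrite dv.
    pose x : leaf H := exist _ v xl.
    have /cards1P[e gE] := xl; have : e \in [set e] := set11 e.
    rewrite -gE inE => /andP[eT ve].
    by rewrite -[inl _]/(TreeV A (val x)) (@deg_TreeV_leaf _ x (exist _ e eT)) // !inE.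
  rewrite -[inl _]/(TreeV A v) deg_TreeV [X in _ + X]big1 ?addn0; last first.
    by move=> [[x xl] i] /= /eqP xv; exfalso; move: xl; rewrite xv dv.
  rewrite -dv /deg -sum1_card; under [RHS]eq_bigl => e do rewrite inE.
  by rewrite big_sub_cond; apply: eq_bigr => e _; rewrite inE.
- have [k <-] := leaf_tail x; have [k' <-] := prev_arc k; rewrite tail_next.
  by rewrite -[inl _]/(LeafV A (arc_head k', i)) deg_LeafV // !inE.
rewrite -[inr _]/(PoleV y) deg_PoleV.
case: (fA k) => -[cA _ _] _; rewrite -(cA (inl y)) /degree deg_closure_pole.
by congr (_ + _); apply: eq_bigr => p _; rewrite !inE.
Qed.

Lemma crosses_tree (U : {set vert TG}) e :
  crosses U (TreeE A e) = crosses [set v | TreeV A v \in U] (val e).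
Proof.
have [[a b] /= ab E] := ends_ex (val e).
rewrite (crossesE _ ab E) (@crossesE TG _ _ (TreeV A a) (TreeV A b)) ?inE //.
by rewrite /= E imsetU1 imset_set1.
Qed.

Lemma crosses_pole (U : {set vert TG}) k (p : pole_edge (A k)) b :
  (forall y : pole_vert (A k), (PoleV y \in U) = b) -> crosses U (PoleE p) = false.
Proof.
move=> yU; have /cards2P[y [y' [yy' E]]] : #|pole_ends p| == 2 by rewrite card_pole_ends.
rewrite (@crossesE TG _ _ (PoleV y) (PoleV y')) ?yU ?addbb //.
  by rewrite (inj_eq (@PoleV_inj _ _ k)).
by rewrite /= E imsetU1 imset_set1.
Qed.

(** The cut around the pole consists of its four dangling edges, an even number. *)
Lemma parity_pole F k : perfect_matching F ->
  ~~ odd (\sum_d (DangE A k d \in F : nat)).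
Proof.
move=> pF; pose U : {set vert TG} := [set v | if v is inr (existT k' _) then k' == k else false].
have := parity_cut U treelike_cubic pF; rewrite !big_edges.
have PU k' (y : pole_vert (A k')) : (PoleV y \in U) = (k' == k) by rewrite inE.
have noT e : crosses U (TreeE A e) = false.
  rewrite crosses_tree (_ : [set v | _] = set0) ?/crosses ?setI0 ?cards0 //.
  by apply/setP => v; rewrite !inE.
have noL z : crosses U (LeafE A z) = false.
  by rewrite (@crossesE TG _ _ (TreeV A (val z.1)) (LeafV A z)) ?inE.
have noP k' (p : pole_edge (A k')) : crosses U (PoleE p) = false.
  exact: (@crosses_pole U k' p (k' == k)).
have dU k' d : crosses U (DangE A k' d) = (k' == k).
  rewrite (@crossesE TG _ _ (PoleV (dangling_end (A k') d)) (LeafV A (arc_end k' d.1, d.2))) //.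
    by rewrite PU inE addbF.
  by rewrite ends_DangE.
(* Stated for every [f], in order to evaluate the cut both for the indicator of [F] and for the
   constant 1. *)
have red f : \sum_(e | crosses U (TreeE A e)) f (TreeE A e) +
    \sum_(z | crosses U (LeafE A z)) f (LeafE A z) +
    \sum_k \sum_(p : pole_edge (A k) | crosses U (PoleE p)) f (PoleE p) +
    \sum_k \sum_(d | crosses U (DangE A k d)) f (DangE A k d) = \sum_d f (DangE A k d) :> nat.
  rewrite [X in X + _ + _ + _]big_pred0 // [X in _ + X + _ + _]big_pred0 //.
  rewrite [X in _ + X + _]big1 ?add0n; last by move=> k' _; rewrite big_pred0.
  rewrite (bigD1 k) //= [X in _ + X]big1 ?addn0.
    by apply: eq_bigl => d; rewrite dU eqxx.
  by move=> k' /negbTE k'k; rewrite big_pred0 // => d; rewrite dU.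
rewrite (red (fun e => (e \in F : nat))) (red (fun=> 1)) => ->.
by rewrite sum1_card card_prod !card_bool.
Qed.

Lemma parity_tree_cut F (X : {set vert H}) (e : {e | e \in htree H}) k k' :
  perfect_matching F -> k != k' ->
  (forall f, f \in htree H -> crosses X f = (f == val e)) ->
  (forall k1, (val (arc_tail k1) \in X) (+) (val (arc_head k1) \in X)
                 = (k1 == k) || (k1 == k')) ->
  odd ((TreeE A e \in F)
    + \sum_i (DangE A k (true, i) \in F : nat) + \sum_i (DangE A k' (true, i) \in F : nat)).
Proof.
move=> pF kk' Xe XK.
(* The vertices x_1 and x_2 go with their leaf, a whole pole with the tail of its arc. So no left
   dangling edge crosses, and the cut has five edges: [e] and the right dangling edges of [k] and
   [k']. *)
pose U : {set vert TG} := [set v | match v with inl (inl v) => v \in X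
  | inl (inr (x, _)) => val x \in X | inr (existT k _) => val (arc_tail k) \in X end].
have := parity_cut U treelike_cubic pF; rewrite !big_edges.
have PU k1 (y : pole_vert (A k1)) : (PoleV y \in U) = (val (arc_tail k1) \in X) by rewrite inE.
have LU x i : (LeafV A (x, i) \in U) = (val x \in X) by rewrite inE.
have cT f : crosses U (TreeE A f) = (f == e).
  rewrite crosses_tree (_ : [set v | _] = X) ?Xe ?(valP f) //.
  by apply/setP => v; rewrite !inE.
have noL z : crosses U (LeafE A z) = false.
  rewrite (@crossesE TG _ _ (TreeV A (val z.1)) (LeafV A z)) ?inE //.
  by case: z => x i; rewrite addbb.
have noP k1 (p : pole_edge (A k1)) : crosses U (PoleE p) = false.
  exact: (@crosses_pole U k1 p (val (arc_tail k1) \in X)).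
have dU k1 d : crosses U (DangE A k1 d) = d.1 && ((k1 == k) || (k1 == k')).
  rewrite (@crossesE TG _ _ (PoleV (dangling_end (A k1) d)) (LeafV A (arc_end k1 d.1, d.2))) //.
    by rewrite PU LU -XK; case: d.1 => //=; rewrite addbb.
  by rewrite ends_DangE.
have red f : \sum_(e | crosses U (TreeE A e)) f (TreeE A e) +
    \sum_(z | crosses U (LeafE A z)) f (LeafE A z) +
    \sum_k \sum_(p : pole_edge (A k) | crosses U (PoleE p)) f (PoleE p) +
    \sum_k \sum_(d | crosses U (DangE A k d)) f (DangE A k d) =
    f (TreeE A e) + \sum_i f (DangE A k (true, i)) + \sum_i f (DangE A k' (true, i)) :> nat.
  rewrite (big_pred1 e) // [X in _ + X + _ + _]big_pred0 // addn0.
  rewrite [X in _ + X + _]big1 ?addn0; last by move=> k1 _; rewrite big_pred0.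
  have inner k1 : (k1 == k) || (k1 == k') ->
      \sum_(d | crosses U (DangE A k1 d)) f (DangE A k1 d) = \sum_i f (DangE A k1 (true, i)).
    move=> kk; rewrite sum_bool2 big_bool -[RHS]addn0; congr (_ + _).
      by apply: eq_bigl => i; rewrite dU kk.
    by apply: big_pred0 => i; rewrite dU.
  rewrite (bigD1 k) //= inner ?eqxx // (bigD1 k') 1?eq_sym //= inner ?eqxx ?orbT //.
  rewrite [X in _ + (_ + (_ + X))]big1 ?addn0 ?addnA // => k1 /andP[n1 n2].
  by rewrite big_pred0 // => d; rewrite dU (negbTE n1) (negbTE n2) andbF.
rewrite (red (fun e => (e \in F : nat))) (red (fun=> 1)) => ->.
by rewrite !sum1_card card_bool.
Qed.

End TreelikeCuts.

(** * Bridgelessness *)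

Lemma connect_map (V W : finType) (a : rel V) (b : rel W) (f : V -> W) x y :
  (forall u v, a u v -> connect b (f u) (f v)) -> connect a x y -> connect b (f x) (f y).
Proof.
move=> ab /connectP[p pp ->]; elim: p x pp => [|z p IH] x /=; first by rewrite connect0.
by case/andP=> /ab xz /IH; apply: connect_trans.
Qed.

Section Bridgeless.
Variables (H : halin) (A : circ_arc H -> fourpole).
Hypothesis cH : cubic H.
Hypothesis fA : forall k, frumious_pole (A k).
Local Notation TG := (treelike_graph A).
Implicit Types (k : circ_arc H).

Section DeletedEdge.
Variable e : edge TG.
Local Notation R := (connect (adj [set~ e])).

Lemma step_edge f (a b : vert TG) : f != e -> ends f = [set a; b] -> R a b.
Proof. by move=> fe E; apply/connect1/(adjI (e := f)); rewrite // !inE. Qed.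

Lemma conn_sym (a b : vert TG) : R a b -> R b a.
Proof. by rewrite connect_adj_sym. Qed.

Lemma step_leaf z : LeafE A z != e -> R (LeafV A z) (TreeV A (val z.1)).
Proof. by move=> ze; apply: conn_sym; apply: step_edge ze _; rewrite ends_LeafE. Qed.

Lemma step_dangling k d : DangE A k d != e ->
  R (PoleV (dangling_end (A k) d)) (LeafV A (arc_end k d.1, d.2)).
Proof. by move=> de; apply: step_edge de _; rewrite ends_DangE. Qed.

(** The new vertices u and v go to the leaves at the ends of the arc, so that a dangling edge
    corresponds to a path of two edges through some x_i. *)
Definition closure_image k (a : vert (pole_closure (A k))) : vert TG :=
  match a with inl y => PoleV y | inr s => TreeV A (val (arc_end k s)) end.

(** The closure stays connected without [e0], and this transfers once every other edge is replaced
    by a walk avoiding [e]; [e0] is the one edge that may lack such a walk. *)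
Lemma closure_conn k (e0 : edge (pole_closure (A k))) :
  (forall p, inl p != e0 -> PoleE p != e) ->
  (forall d, inr (Some d) != e0 ->
     R (PoleV (dangling_end (A k) d)) (TreeV A (val (arc_end k d.1)))) ->
  (inr None != e0 -> R (TreeV A (val (arc_tail k))) (TreeV A (val (arc_head k)))) ->
  forall a b, R (@closure_image k a) (@closure_image k b).
Proof.
move=> eP eD eN a b; case: (fA k) => -[_ [_ /(_ e0) bA] _] _.
apply: connect_map (bA a b) => {a b} u v /adjP[f + E]; rewrite !inE => fe0.
have img g (x y : vert TG) : [set closure_image w | w in ends g] = [set x; y] -> R x y ->
    ends g = [set u; v] -> R (closure_image u) (closure_image v).
  move=> E1 xy Eg.
  have : closure_image v \in [set x; y] by rewrite -E1 Eg; apply: imset_f; rewrite set22.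
  have : closure_image u \in [set x; y] by rewrite -E1 Eg; apply: imset_f; rewrite set21.
  have yx := conn_sym xy.
  by rewrite !inE => /orP[]/eqP-> /orP[]/eqP->; rewrite ?connect0.
case: f fe0 E => [p|[d|]] fe0 E.
- have /cards2P[y [y' [_ Ey]]] : #|pole_ends p| == 2 by rewrite card_pole_ends.
  apply: (img _ (PoleV y) (PoleV y') _ _ E).
    by rewrite /= Ey imsetU1 imset_set1 imsetU1 imset_set1.
  by apply: step_edge (eP p fe0) _; rewrite /= Ey imsetU1 imset_set1.
- apply: (img _ _ _ _ (eD d fe0) E).
  by rewrite /= imsetU1 imset_set1 /= setUC.
- apply: (img _ _ _ _ (eN fe0) E).
  by rewrite /= imsetU1 imset_set1.
Qed.

Lemma all_connected :
  (forall u v, R (TreeV A u) (TreeV A v)) ->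
  (forall z, R (LeafV A z) (TreeV A (val z.1))) ->
  (forall k (y : pole_vert (A k)), exists v, R (PoleV y) (TreeV A v)) ->
  connected [set~ e].
Proof.
move=> RT RL RP.
have RV a : exists v, R a (TreeV A v).
  by case: a => [[v|z]|[k y]]; [exists v; apply: RT|eexists; apply: RL|apply: RP].
move=> a b; have [v av] := RV a; have [w bw] := RV b.
by apply: connect_trans av _; apply: connect_trans (RT v w) (conn_sym bw).
Qed.

End DeletedEdge.

(** Without a tree edge, every tree vertex still reaches a leaf, and the leaves are linked around
    the circuit, since each closure is connected without uv. Without any other edge the tree is
    intact, and only the damaged pole or leaf vertex needs a detour. *)
Lemma treelike_connected e : connected [set~ e : edge TG].
Proof.
have step2 k d : LeafE A (arc_end k d.1, d.2) != e -> DangE A k d != e ->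
    connect (adj [set~ e]) (PoleV (dangling_end (A k) d)) (TreeV A (val (arc_end k d.1))).
  by move=> le de; apply: connect_trans (step_dangling de) (step_leaf le).
have treeR (F : {set edge H}) u v : (forall f : {f | f \in htree H}, val f \in F -> TreeE A f != e) ->
    F \subset htree H -> connect (adj F) u v -> connect (adj [set~ e]) (TreeV A u) (TreeV A v).
  move=> fe /subsetP sF; apply: connect_map => {u v} u v /adjP[f fF E].
  apply: (@step_edge e (TreeE A (exist _ f (sF f fF)))); first exact: fe.
  by rewrite /= E imsetU1 imset_set1.
have [[cT aT] degT] : spanning_tree (htree H) /\ forall v, deg (htree H) v = 1 \/ 2 < deg (htree H) v.
  by split=> [|v]; [apply: htreeP | case: (deg_tree cH v) => ->; [left|right]].
case: e step2 treeR => [[[e1|[x i]]|[k0 p0]]|[k0 d0]] step2 treeR.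
- have RL z : connect (adj [set~ TreeE A e1]) (LeafV A z) (TreeV A (val z.1)).
    exact: step_leaf.
  have RK k : forall a b, connect (adj [set~ TreeE A e1]) (@closure_image k a) (@closure_image k b).
    by apply: (@closure_conn _ k (inr None)) => // d _; apply: step2.
  apply: all_connected => // [u v|k y]; last first.
    by exists (val (arc_tail k)); apply: (RK k (inl y) (inr false)).
  have Rleaf w : exists k, connect (adj [set~ TreeE A e1]) (TreeV A w) (TreeV A (val (arc_tail k))).
    have [x xl wx] := reach_leaf (val e1) w (conj cT aT) degT.
    have [k kx] := leaf_tail (exist _ x xl); exists k; rewrite kx.
    apply: treeR wx; last exact: subsetDl.
    by move=> f; rewrite !inE => /andP[+ _]; apply: contra => /eqP[->].
  have [k uk] := Rleaf u; have [k' vk'] := Rleaf v.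
  apply: connect_trans uk _; apply: conn_sym; apply: connect_trans vk' _; apply: conn_sym.
  move: k'; apply: (arc_ind (k0 := k)) => [k'|]; last exact: connect0.
  by move/connect_trans; apply; rewrite tail_next; apply: (RK k' (inr false) (inr true)).
- pose e := LeafE A (x, i).
  have RT u v : connect (adj [set~ e]) (TreeV A u) (TreeV A v).
    by apply: treeR (cT u v).
  have RL z : connect (adj [set~ e]) (LeafV A z) (TreeV A (val z.1)).
    have [->|zx] := eqVneq z (x, i); last first.
      by apply: step_leaf; apply: contra zx => /eqP[->].
    (* x_i has lost its edge to [x]; it enters the pole that starts at [x] and returns to [x]
       without using that dangling edge again. *)
    have [k kx] := leaf_tail x; rewrite -kx.
    apply: connect_trans (conn_sym (@step_dangling e k (false, i) isT)) _.
    apply: (@closure_conn e k (inr (Some (false, i))) _ _ _ (inl _) (inr false)) => //= -[s j] sj.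
    apply: step2 => //; apply: contra sj => /eqP[+ ->].
    by case: s => //= E; have := tail_neq_head k; rewrite E kx eqxx.
  apply: all_connected => // k y; exists (val (arc_tail k)).
  apply: (@closure_conn e k (inr None) _ _ _ (inl y) (inr false)) => // d _.
  by apply: connect_trans (@step_dangling e k d isT) (RL _).
- pose e : edge TG := PoleE p0.
  have RT u v : connect (adj [set~ e]) (TreeV A u) (TreeV A v).
    by apply: treeR (cT u v).
  apply: all_connected => // [z|k y]; first exact: step_leaf.
  exists (val (arc_tail k)); have [kk|nk] := eqVneq k0 k.
    subst k; apply: (@closure_conn e k0 (inl p0) _ _ _ (inl y) (inr false)) => // [p|d _]; last exact: step2.
    by apply: contra => /eqP[] /eqP; rewrite eq_Tagged => /eqP /= ->.
  apply: (@closure_conn e k (inr None) _ _ _ (inl y) (inr false)) => // [p _|d _]; last exact: step2.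
  by apply: contra nk => /eqP[E _]; rewrite E.
pose e : edge TG := DangE A k0 d0.
have RT u v : connect (adj [set~ e]) (TreeV A u) (TreeV A v).
  by apply: treeR (cT u v).
apply: all_connected => // [z|k y]; first exact: step_leaf.
exists (val (arc_tail k)).
apply: (@closure_conn e k (inr (Some d0)) _ _ _ (inl y) (inr false)) => // d dd0.
by apply: step2 => //; apply: contra dd0 => /eqP[_ ->].
Qed.

Lemma treelike_bridgeless : bridgeless TG.
Proof.
split; last exact: treelike_connected.
pose k : circ_arc H := exist _ (outer_dart (hplane H)) (porbit_id _ _).
move=> a b; apply: connect_adjS (treelike_connected (DangE A k (false, false)) a b).
exact: subsetT.
Qed.

End Bridgeless.

(** * Colourings *)

Section Colouring.
Variables (H : halin) (A : circ_arc H -> fourpole).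
Hypothesis cH : cubic H.
Hypothesis fA : forall k, frumious_pole (A k).
Local Notation TG := (treelike_graph A).
Variables (t : nat) (M : {set edge TG}) (s : edge TG -> {set 'I_(t + 3)}).
Hypothesis gs : good M s.
Implicit Types (k : circ_arc H) (F : {set edge TG}).

Let pM : perfect_matching M. Proof. by case: gs. Qed.
Let sz e : #|s e| = if e \in M then t.+1 else 1. Proof. by case: gs. Qed.
Let pC c : perfect_matching [set e | c \in s e]. Proof. by case: gs. Qed.

Let S k (side i : bool) := s (DangE A k (side, i)).
Let m k (side i : bool) : nat := DangE A k (side, i) \in M.
Let mm k side := m k side false + m k side true.

Lemma parity_sides F k : perfect_matching F ->
  odd ((DangE A k (false, false) \in F) + (DangE A k (false, true) \in F)) =
  odd ((DangE A k (true, false) \in F) + (DangE A k (true, true) \in F)).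
Proof.
move/(parity_pole cH fA k); rewrite sum_bool2 !big_bool.
by do 4!case: (_ \in F).
Qed.

Lemma parity_mm k : odd (mm k false) = odd (mm k true).
Proof. exact: parity_sides. Qed.

Lemma parity_S k c : (c \in S k false false) (+) (c \in S k false true) =
  (c \in S k true false) (+) (c \in S k true true).
Proof. by have := parity_sides k (pC c); rewrite !oddD !oddb !inE. Qed.

Lemma mm_le2 k side : mm k side <= 2.
Proof. by rewrite /mm /m; do 2!case: (_ \in M). Qed.

Lemma card_S k side i : #|S k side i| = if m k side i == 1 then t.+1 else 1.
Proof. by rewrite /S sz /m; case: (_ \in M). Qed.

(** Otherwise the colour sets are disjoint on both sides, and giving uv the remaining colours yields
    a good colouring of the closure, which is frumious. *)
Lemma pole_meet k side : mm k false <= 1 -> mm k true <= 1 ->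
  ~~ [disjoint S k side false & S k side true].
Proof.
move=> m0 m1; have mE : mm k false = mm k true.
  by have := parity_mm k; move: m0 m1; case: (mm k false) (mm k true) => [|[|?]] [|[|?]].
pose W := [set c | (c \in S k false false) (+) (c \in S k false true)].
have cW sd : #|S k sd false| + #|S k sd true| = #|W| + #|S k sd false :&: S k sd true|.*2.
  have -> : W = [set c | (c \in S k sd false) (+) (c \in S k sd true)].
    by apply/setP => c; rewrite !inE; case: sd; rewrite ?parity_S.
  rewrite -cardsUI -addnn addnA; congr (_ + _); rewrite -cardsUI.
  rewrite [X in _ + #|pred_of_set X|](_ : _ = set0) ?cards0 ?addn0.
    by congr #|pred_of_set _|; apply/setP => c; rewrite !inE; do 2!case: (c \in _).
  by apply/setP => c; rewrite !inE; do 2!case: (c \in _).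
have cS sd : #|S k sd false| + #|S k sd true| = if mm k sd == 0 then 2 else t + 2.
  have : mm k sd <= 1 by case: sd.
  by rewrite !card_S /mm; case: (m k sd false) (m k sd true) => [|[|?]] [|[|?]] //= _; lia.
apply/negP => dis.
(* The sizes have equal sums on both sides and [W] is common to them, so the intersections have
   equal size too. *)
have dis2 sd : [disjoint S k sd false & S k sd true].
  rewrite -setI_eq0 -cards_eq0.
  have : #|S k side false :&: S k side true| = 0.
    by apply/eqP; rewrite cards_eq0 setI_eq0.
  move: (cW sd) (cW side); rewrite !cS.
  have -> : mm k sd = mm k side by case: sd side {dis} => [] [].
  by lia.
have disc sd c : c \in S k sd false -> c \in S k sd true -> False.
  by move=> c0 c1; have /disjointFr/(_ c0) := dis2 sd; rewrite c1.
(* uv must lie in [M'] exactly when no dangling edge does. The colours missing on the left then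
   number (t + 3) - 2 = t + 1 if uv is in [M'], and (t + 3) - (t + 2) = 1 otherwise. *)
pose M' := [set e : edge (pole_closure (A k)) | match e with
  | inl p => PoleE p \in M
  | inr (Some d) => DangE A k d \in M
  | inr None => mm k false == 0 end].
pose s' (e : edge (pole_closure (A k))) := match e with
  | inl p => s (PoleE p)
  | inr (Some d) => s (DangE A k d)
  | inr None => ~: (S k false false :|: S k false true) end.
have [frA _] := fA k; apply: (@frumious_not_good _ (inr false : vert (pole_closure (A k))) t M' s' frA).
have degP (F' : {set edge (pole_closure (A k))}) F y :
    (forall p, (inl p \in F') = (PoleE p \in F)) ->
    (forall d, (inr (Some d) \in F') = (DangE A k d \in F)) ->
    deg F' (inl y : vert (pole_closure (A k))) = deg F (PoleV y).
  move=> eP eD; rewrite deg_closure_pole deg_PoleV.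
  by congr (_ + _); apply: eq_bigr => a _; rewrite ?eP ?eD.
split=> [[y|sd]|[p|[d|]]|c [y|sd]].
- by rewrite (degP _ M) // => a; rewrite inE.
- have : mm k sd <= 1 by case: sd.
  rewrite deg_closure_new !inE (_ : mm k false = mm k sd); last by case: sd.
  by rewrite /mm /m; do 2!case: (_ \in M).
- by rewrite sz inE.
- by rewrite sz inE.
- rewrite /s' inE; have := cardsC (S k false false :|: S k false true).
  have := cardsUI (S k false false) (S k false true).
  have -> : S k false false :&: S k false true = set0.
    by apply/eqP; rewrite setI_eq0 dis2.
  by rewrite cards0 cS card_ord; case: (mm k false == 0); lia.
- by rewrite (degP _ [set e | c \in s e]) ?pC // => a; rewrite !inE.
rewrite deg_closure_new !inE /= -/(S k sd false) -/(S k sd true) -/(S k false false) -/(S k false true).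
have := disc sd c; have := disc false c; have := parity_S k c.
by case: sd; do 4?case: (c \in _) => //=; move=> // _ D1 D2; exfalso; auto.
Qed.

(** Here [e] is the tree edge at a leaf x, [q i] are the edges from x to x_1 and x_2, and [p i],
    [r i] the dangling edges there of the two neighbouring poles. The abstract form allows [p] and
    [r] to be exchanged. *)
Lemma leaf_core (e : edge TG) (q p r : bool -> edge TG) j :
  (forall F i, perfect_matching F -> (q i \in F) + (p i \in F) + (r i \in F) = 1) ->
  (forall F, perfect_matching F -> (e \in F) + (q false \in F) + (q true \in F) = 1) ->
  ((p false \in M) + (p true \in M) = 1 -> ~~ [disjoint s (p false) & s (p true)]) ->
  e \notin M -> q j \in M -> p (~~ j) \in M ->
  [/\ (r false \in M) + (r true \in M) = 0, s (r false) != s (r true) &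
      (p false \in M) + (p true \in M) = 1].
Proof.
move=> h1 h2 meet eM qj pi.
have pj : p j \notin M by have := h1 M j pM; rewrite qj; case: (p j \in M).
have rj : r j \notin M by have := h1 M j pM; rewrite qj; case: (p j \in M); case: (r j \in M).
have ri : r (~~ j) \notin M.
  by have := h1 M (~~ j) pM; rewrite pi; case: (q _ \in M); case: (r _ \in M).
have sum_p : (p false \in M) + (p true \in M) = 1.
  by move: pj pi; case: (j) => /= /negbTE-> ->.
have sum_r : (r false \in M) + (r true \in M) = 0.
  by move: rj ri; case: (j) => /= /negbTE-> /negbTE->.
split=> //; apply/eqP => rr.
have /eqP/cards1P[a pa] : #|s (p j)| = 1 by rewrite sz (negbTE pj).
have /eqP/cards1P[b rb] : #|s (r j)| = 1 by rewrite sz (negbTE rj).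
have /eqP/cards1P[c ec] : #|s e| = 1 by rewrite sz (negbTE eM).
have rib : s (r (~~ j)) = [set b] by rewrite -rb; case: (j); rewrite rr.
have api : a \in s (p (~~ j)).
  have : ~~ [disjoint s (p j) & s (p (~~ j))].
    by have := meet sum_p; case: (j); rewrite // disjoint_sym.
  by rewrite pa disjoints1 negbK.
have h1' i c' : (c' \in s (q i)) + (c' \in s (p i)) + (c' \in s (r i)) = 1.
  by have := h1 _ i (pC c'); rewrite !inE.
have h2' c' : (c' \in s e) + (c' \in s (q j)) + (c' \in s (q (~~ j))) = 1.
  by have := h2 _ (pC c'); rewrite !inE; case: (j); rewrite //= addnAC.
(* The colour [a] is on both [p] edges, so on neither [q] edge, and at x only [e] is left to carry
   it. The same holds for [b] and the [r] edges. *)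
have ac : a = c.
  have := h2' a; have := h1' j a; have := h1' (~~ j) a.
  rewrite api pa ec !in_set1 eqxx.
  by case: (eqVneq a c) => // _; do 4!case: (a \in _).
have bc : b = c.
  have := h2' b; have := h1' j b; have := h1' (~~ j) b.
  rewrite rib rb ec !in_set1 eqxx.
  by case: (eqVneq b c) => // _; do 4!case: (b \in _).
(* Now [p j] and [r j], which share an end, have the same colour. *)
by have := h1' j a; rewrite pa rb ac bc !in_set1 eqxx; case: (c \in _).
Qed.

(** Exactly one [q j] is in [M]; the other leaf vertex is matched by a [p] edge or an [r] edge, and
    these two cases are symmetric. *)
Lemma leaf_unmatched (e : edge TG) (q p r : bool -> edge TG) :
  (forall F i, perfect_matching F -> (q i \in F) + (p i \in F) + (r i \in F) = 1) ->
  (forall F, perfect_matching F -> (e \in F) + (q false \in F) + (q true \in F) = 1) ->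
  ((p false \in M) + (p true \in M) = 1 -> ~~ [disjoint s (p false) & s (p true)]) ->
  ((r false \in M) + (r true \in M) = 1 -> ~~ [disjoint s (r false) & s (r true)]) ->
  e \notin M ->
  [/\ (r false \in M) + (r true \in M) = 0, s (r false) != s (r true) &
      (p false \in M) + (p true \in M) = 1] \/
  [/\ (p false \in M) + (p true \in M) = 0, s (p false) != s (p true) &
      (r false \in M) + (r true \in M) = 1].
Proof.
move=> h1 h2 mp mr eM.
have [j qj qi] : exists2 j, q j \in M & q (~~ j) \notin M.
  have := h2 M pM; rewrite (negbTE eM) add0n.
  case qf: (q false \in M); case qt: (q true \in M) => // _.
    by exists false; rewrite ?qf ?qt.
  by exists true; rewrite ?qf ?qt.
have [pi|pi] := boolP (p (~~ j) \in M); first by left; apply: leaf_core h1 h2 mp eM qj pi.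
right; apply: (leaf_core _ h2 mr eM qj) => [F i pF|]; first by rewrite addnAC h1.
by have := h1 M (~~ j) pM; rewrite (negbTE qi) (negbTE pi); case: (r _ \in M).
Qed.

Lemma leaf_tree_edge (x : leaf H) : exists e : {e | e \in htree H}, val x \in ends (val e).
Proof.
have /cards1P[e gE] := valP x; have : e \in [set e] := set11 e.
by rewrite -gE inE => /andP[eT xe]; exists (exist _ e eT).
Qed.

Lemma deg_leaf_pm F k i : perfect_matching F ->
  (LeafE A (arc_head k, i) \in F) + (DangE A k (true, i) \in F)
  + (DangE A (next_arc k) (false, i) \in F) = 1.
Proof. by move=> pF; rewrite -deg_LeafV. Qed.

Lemma matched_leaf k (e : {e | e \in htree H}) : val (arc_head k) \in ends (val e) ->
  TreeE A e \in M -> mm k true + mm (next_arc k) false = 2.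
Proof.
move=> xe eM; have := pM (TreeV A (val (arc_head k))); rewrite (deg_TreeV_leaf M xe) eM.
have := deg_leaf_pm k true pM; have := deg_leaf_pm k false pM; rewrite /mm /m.
by do 2!case: (LeafE A _ \in M) => //; lia.
Qed.

Lemma unmatched_leaf k (e : {e | e \in htree H}) : val (arc_head k) \in ends (val e) ->
  TreeE A e \notin M ->
  [/\ mm (next_arc k) false = 0, S (next_arc k) false false != S (next_arc k) false true &
      mm k true = 1] \/
  [/\ mm k true = 0, S k true false != S k true true & mm (next_arc k) false = 1].
Proof.
move=> xe eM.
(* By parity the opposite side also has exactly one matching edge, so [pole_meet] applies. *)
have meet k' side : mm k' side = 1 -> ~~ [disjoint S k' side false & S k' side true].
  move=> m1; have [] : mm k' false <= 1 /\ mm k' true <= 1; last exact: pole_meet.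
  have := parity_mm k'; have := mm_le2 k' false; have := mm_le2 k' true.
  by case: side m1 => ->; case: (mm k' _) => [|[|[|?]]].
apply: (@leaf_unmatched (TreeE A e) (fun i => LeafE A (arc_head k, i))
  (fun i => DangE A k (true, i)) (fun i => DangE A (next_arc k) (false, i))) => //.
- by move=> F i pF; apply: deg_leaf_pm.
- by move=> F pF; rewrite -(deg_TreeV_leaf F xe) pF.
- exact: meet.
- exact: meet.
Qed.

Lemma face_cut_edges k : exists (e1 e2 : {e | e \in htree H}) k',
  [/\ val (arc_tail k) \in ends (val e1), TreeE A e1 \in M -> TreeE A e2 \notin M, k != k' &
   forall F, perfect_matching F -> odd ((TreeE A e2 \in F)
    + \sum_i (DangE A k (true, i) \in F : nat) + \sum_i (DangE A k' (true, i) \in F : nat))].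
Proof.
have [e1 [e2 [X [k' [[e1T e2T e12] [xe1 [w we1 we2]] kk' XT XK]]]]] := arc_face_cut cH k.
exists (exist _ e1 e1T), (exist _ e2 e2T), k'; split=> // [e1M|F pF]; last first.
  exact: (parity_tree_cut cH fA (e := exist _ e2 e2T) pF kk' XT XK).
apply: contra e12 => e2M; suff [->] : TreeE A (exist _ e1 e1T) = TreeE A (exist _ e2 e2T) by [].
by apply: (@pm_inj TG M (TreeV A w)) => //; rewrite TreeV_TreeE.
Qed.

Lemma treelike_not_good : False.
Proof.
pose k0 : circ_arc H := exist _ (outer_dart (hplane H)) (porbit_id _ _).
have mmE k side : \sum_i (DangE A k (side, i) \in M : nat) = mm k side.
  by rewrite big_bool /= addnC.
(* If all leaf edges were in [M], all poles would have the same parity by [matched_leaf], and the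
   cut of [face_cut_edges], with [e2] outside [M], would contain an even number of matching
   edges. *)
have [k [ek [xk nk]]] : exists k (e : {e | e \in htree H}),
    val (arc_head k) \in ends (val e) /\ TreeE A e \notin M.
  apply: contrapT => no.
  have allM k (e : {e | e \in htree H}) : val (arc_head k) \in ends (val e) -> TreeE A e \in M.
    by move=> xe; apply: contrapT => /negP eM; apply: no; exists k, e.
  have par k : odd (mm (next_arc k) false) = odd (mm k false).
    have [e xe] := leaf_tree_edge (arc_head k).
    have := matched_leaf xe (allM _ _ xe); have := parity_mm k.
    by move=> -> /(congr1 odd); rewrite oddD; do 2!case: odd.
  have [e1 [e2 [k' [xe1 e12 _ /(_ M pM)]]]] := face_cut_edges k0.
  have e1M : TreeE A e1 \in M.
    by have [k1 k1E] := prev_arc k0; apply: (allM k1); rewrite -tail_next k1E.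
  rewrite (negbTE (e12 e1M)) !mmE add0n oddD -!parity_mm.
  have -> : odd (mm k' false) = odd (mm k0 false).
    by move: k'{e12}; apply: (arc_ind (k0 := k0)) => // k1; rewrite par.
  by rewrite addbb.
(* Otherwise a side without matching edges faces a side with two. Such a pole passes this pattern on
   to the next one at every leaf: an unmatched leaf allows no side with two. Going round the circuit
   contradicts the side with one at the unmatched leaf of [k]. *)
have [k1 k1f k1t] : exists2 k, mm k false = 0 & mm k true = 0.
  apply: contrapT => no.
  have R2 k1 : mm k1 false = 0 -> mm k1 true = 2.
    move=> z; have := mm_le2 k1 true; have := parity_mm k1; rewrite z.
    case E: (mm k1 true) => [|[|[|?]]] //; by case: no; exists k1.
  have L2 k1 : mm k1 true = 0 -> mm k1 false = 2.
    move=> z; have := mm_le2 k1 false; have := parity_mm k1; rewrite z.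
    case E: (mm k1 false) => [|[|[|?]]] //; by case: no; exists k1.
  have [[nf _ tk]|[tk _ nf]] := unmatched_leaf xk nk.
    have all0 k1 : mm k1 false = 0.
      apply: (arc_ind (Q := fun k1 => mm k1 false = 0) _ nf) => k2 /R2 k2t.
      have [e xe] := leaf_tree_edge (arc_head k2); have [eM|eM] := boolP (TreeE A e \in M).
        by have := matched_leaf xe eM; rewrite k2t; lia.
      by case: (unmatched_leaf xe eM) => -[]; rewrite k2t.
    by have := R2 _ (all0 k); rewrite tk.
  (* The mirrored case propagates backwards, so the induction runs forwards on the negation. *)
  have all0 k1 : mm k1 true = 0.
    apply: contrapT => /eqP nk1.
    suff /eqP : mm k true != 0 by [].
    apply: (arc_ind (Q := fun k1 => mm k1 true != 0) _ nk1) => k2; apply: contra => /eqP k2t.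
    have [e xe] := leaf_tree_edge (arc_head k2); have [eM|eM] := boolP (TreeE A e \in M).
      by have := matched_leaf xe eM; rewrite (L2 _ k2t); lia.
    by case: (unmatched_leaf xe eM) => -[]; rewrite (L2 _ k2t).
  by have := L2 _ (all0 (next_arc k)); rewrite nf.
have Seq side : S k1 side false = S k1 side true.
  have c1 i : #|S k1 side i| = 1.
    rewrite card_S; have : mm k1 side = 0 by case: side.
    by rewrite /mm; case: i; case: (m k1 side _) (m k1 side _) => [|?] [|?].
  have := pole_meet side (k := k1); rewrite k1f k1t => /(_ isT isT).
  have /eqP/cards1P[a ->] := c1 false; have /eqP/cards1P[b ->] := c1 true.
  by rewrite disjoints1 negbK inE => /eqP->.
have [e1 [e2 [k2 [xe1 e12 _ cut]]]] := face_cut_edges k1.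
(* An unmatched leaf would require a side without matching edges to have two different colour sets,
   against [Seq]. *)
have e1M : TreeE A e1 \in M.
  apply: contrapT => /negP e1M; have [k3 k3E] := prev_arc k1.
  rewrite -k3E tail_next in xe1; have := unmatched_leaf xe1 e1M; rewrite k3E k1f.
  by case=> -[]; rewrite ?Seq ?eqxx.
have e2M := e12 e1M.
have k2t : mm k2 true = 1.
  have := cut M pM; rewrite (negbTE e2M) !mmE k1t; have := mm_le2 k2 true.
  by case: (mm k2 true) => [|[|[|?]]].
have k2f : mm k2 false <= 1.
  have := mm_le2 k2 false; have := parity_mm k2; rewrite k2t.
  by case: (mm k2 false) => [|[|[|?]]].
have /pred0Pn[c0 /andP[/= c0f c0t]] := pole_meet true k2f (eq_leq k2t).
(* The equal colour sets on the right of [k1] cancel modulo 2. *)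
have cutC c : (c \in s (TreeE A e2)) (+) (c \in S k2 true false) (+) (c \in S k2 true true).
  have := cut _ (pC c); rewrite !big_bool /= !inE.
  rewrite -/(S k1 true true) -/(S k1 true false) Seq addnn.
  by rewrite !oddD odd_double !oddb addbF addbA addbAC.
have e2c0 : s (TreeE A e2) = [set c0].
  have /eqP/cards1P[c E] : #|s (TreeE A e2)| = 1 by rewrite sz (negbTE e2M).
  by have := cutC c0; rewrite c0f c0t E inE addbT; case: eqP => [->|].
(* The single colour of [e2] is the common colour [c0], so every other colour must lie on exactly
   one right edge of [k2]. But these sets have sizes t + 1 and 1 and they meet, so they cover at
   most t + 1 colours. *)
have cover : S k2 true false :|: S k2 true true = setT.
  apply/setP => c; rewrite !inE; have := cutC c; rewrite e2c0 inE.
  by have [->|_] := eqVneq c c0; rewrite ?c0f //=; case: (_ \in _).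
have := cardsUI (S k2 true false) (S k2 true true); rewrite cover cardsT card_ord.
have : 0 < #|S k2 true false :&: S k2 true true|.
  by apply/card_gt0P; exists c0; rewrite inE c0f.
rewrite !card_S; move: k2t; rewrite /mm.
by case: (m k2 true false) (m k2 true true) => [|[|?]] [|[|?]] //= _; lia.
Qed.

End Colouring.

Theorem theorem5p6 (G : mgraph) : treelike_snark G -> frumious G.
Proof.
case=> H [A [cH fA iso]].
pose x : vert (treelike_graph A) := TreeV A (dvert (outer_dart (hplane H))).
apply: (isomorphic_frumious x iso); apply: (not_good_frumious x).
- exact: treelike_cubic.
- exact: treelike_bridgeless.
by move=> t M s; apply: treelike_not_good.
Qed.
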